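(* Let $p > 2$ be a prime and let $K_{\mathfrak p}$ be a finite extension of $\mathbb{Q}_p$ with residue field $\mathbb{F}_q$. Then for monic quadratic polynomials with coefficients in $\mathfrak{O}_{\mathfrak p}$, $$\nu_{2,\mathfrak p}\left(P_{2,\mathfrak p}(\mathrm{id})\right) = \nu_{2,\mathfrak p}\left(P_{2,\mathfrak p}(1,1)\right) = \frac12 - \frac{1}{2q+2},$$ $$\nu_{2,\mathfrak p}\left(P_{2,\mathfrak p}(\mathbb{Z}/2\mathbb{Z})\right) = \nu_{2,\mathfrak p}\left(P_{2,\mathfrak p}(2)\right) = \frac12 + \frac{1}{2q+2}.$$
   Context: $\mathfrak{O}_{\mathfrak p}$ is the ring of integers of $K_{\mathfrak p}$. $\nu_{2,\mathfrak p}$ is the product measure on $(\mathfrak{O}_{\mathfrak p})^2$ of the additive Haar measure on $\mathfrak{O}_{\mathfrak p}$ normalized to total mass $1$. A tuple $(a_0,a_1) \in (\mathfrak{O}_{\mathfrak p})^2$ is identified with the monic polynomial $f(x) = x^2 + a_1 x + a_0$. $P_{2,\mathfrak p}(1,1)$ (resp. $P_{2,\mathfrak p}(2)$) is the set of tuples whose polynomial is a product of two distinct monic linear polynomials over $\mathfrak{O}_{\mathfrak p}$ (resp. is irreducible). For a group $G$ (the trivial group $\mathrm{id}$ or $\mathbb{Z}/2\mathbb{Z}$), $P_{2,\mathfrak p}(G)$ is the set of tuples for which the Galois group over $K_{\mathfrak p}$ of the splitting field of $f$ is isomorphic to $G$. (Polynomials with repeated roots form a null set.) *)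

(* Defs.v *)
From HB Require Import structures.
From mathcomp Require Import all_boot all_order all_fingroup all_algebra all_solvable all_field.
From mathcomp Require Import all_classical all_reals all_analysis.

Set Implicit Arguments.
Unset Strict Implicit.
Unset Printing Implicit Defensive.

Import Order.TTheory GRing.Theory Num.Theory.

Local Open Scope classical_set_scope.
Local Open Scope ring_scope.

(* The ring Z_p is the projective limit of the rings Z/p^n: an element is the  *)
(* compatible sequence of its residues, the n-th one being represented by an   *)
(* integer in [0, p^n[.  The proof of primality is an argument of the type so  *)
(* that the integral domain structure can be attached to it.                   *)
Record padic_int (p : nat) (p_pr : prime p) := PadicInt {
  residues :> nat -> int;
  residuesP : `[< forall n, (residues n.+1 %% (p ^ n)%N)%Z = residues n >] }.

HB.instance Definition _ p p_pr := [isSub for @residues p p_pr].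
HB.instance Definition _ p p_pr := [Choice of @padic_int p p_pr by <:].

Section PadicIntRing.
Variables (p : nat) (p_pr : prime p).
Local Notation Zp := (padic_int p_pr).
Implicit Types (u v w : Zp).

Let residuesS u n : (u n.+1 %% (p ^ n)%N)%Z = u n.
Proof. by case: u => u /= /asboolP. Qed.

Let residues_mod u n : (u n %% (p ^ n)%N)%Z = u n.
Proof. by rewrite -[in RHS]residuesS -[in LHS]residuesS modz_mod. Qed.

Let mod_mod (z : int) m n :
  ((z %% (p ^ (m + n))%N)%Z %% (p ^ n)%N)%Z = (z %% (p ^ n)%N)%Z.
Proof.
rewrite [in RHS](divz_eq z (p ^ (m + n))%N) expnD PoszM mulrA.
by rewrite modzMDl.
Qed.

Let residues_ext u v : (forall n, u n = v n) -> u = v.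
Proof. by move=> uv; apply/val_inj/funext. Qed.

Lemma padic_int_mk_subproof (f : nat -> int) :
  (forall n, f n.+1 = f n %[mod (p ^ n)%N])%Z ->
  `[< forall n, ((f n.+1 %% (p ^ n.+1)%N)%Z %% (p ^ n)%N)%Z
                = (f n %% (p ^ n)%N)%Z >].
Proof. by move=> fP; apply/asboolP => n; rewrite (mod_mod _ 1). Qed.

Definition padic_int_mk f fP : Zp :=
  PadicInt p_pr (@padic_int_mk_subproof f fP).

Let lift_residues u n : (u n.+1 = u n %[mod (p ^ n)%N])%Z.
Proof. by rewrite residuesS residues_mod. Qed.

Lemma padic_int_addP u v n :
  (u n.+1 + v n.+1 = u n + v n %[mod (p ^ n)%N])%Z.
Proof. by rewrite -modzDm !lift_residues modzDm. Qed.

Lemma padic_int_mulP u v n :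
  (u n.+1 * v n.+1 = u n * v n %[mod (p ^ n)%N])%Z.
Proof. by rewrite -modzMm !lift_residues modzMm. Qed.

Lemma padic_int_oppP u n : (- u n.+1 = - u n %[mod (p ^ n)%N])%Z.
Proof. by rewrite -modzNm lift_residues modzNm. Qed.

Lemma padic_int_constP (z : int) n : (z = z %[mod (p ^ n)%N])%Z.
Proof. by []. Qed.

Definition padic_int_const z : Zp := padic_int_mk (padic_int_constP z).
Definition padic_int_add u v : Zp := padic_int_mk (padic_int_addP u v).
Definition padic_int_opp u : Zp := padic_int_mk (padic_int_oppP u).
Definition padic_int_mul u v : Zp := padic_int_mk (padic_int_mulP u v).

Lemma padic_int_addA : associative padic_int_add.
Proof.
by move=> u v w; apply: residues_ext => n /=; rewrite modzDmr modzDml addrA.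
Qed.

Lemma padic_int_addC : commutative padic_int_add.
Proof. by move=> u v; apply: residues_ext => n /=; rewrite addrC. Qed.

Lemma padic_int_add0 : left_id (padic_int_const 0) padic_int_add.
Proof.
by move=> u; apply: residues_ext => n /=; rewrite modzDml add0r residues_mod.
Qed.

Lemma padic_int_addN :
  left_inverse (padic_int_const 0) padic_int_opp padic_int_add.
Proof.
by move=> u; apply: residues_ext => n /=; rewrite modzDml addNr.
Qed.

HB.instance Definition _ := GRing.isZmodule.Build Zp
  padic_int_addA padic_int_addC padic_int_add0 padic_int_addN.

Lemma padic_int_mulA : associative padic_int_mul.
Proof.
by move=> u v w; apply: residues_ext => n /=; rewrite modzMmr modzMml mulrA.
Qed.

Lemma padic_int_mulC : commutative padic_int_mul.
Proof. by move=> u v; apply: residues_ext => n /=; rewrite mulrC. Qed.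

Lemma padic_int_mul1 : left_id (padic_int_const 1) padic_int_mul.
Proof.
by move=> u; apply: residues_ext => n /=; rewrite modzMml mul1r residues_mod.
Qed.

Lemma padic_int_mulD : left_distributive padic_int_mul +%R.
Proof.
move=> u v w; apply: residues_ext => n /=.
by rewrite modzMml mulrDl modzDm.
Qed.

Lemma padic_int_one_neq0 : padic_int_const 1 != 0 :> Zp.
Proof.
apply/eqP => /(congr1 (fun u : Zp => u 1%N)) /=.
by rewrite expn1 modz_small ?mod0z //= ltz_nat prime_gt1.
Qed.

HB.instance Definition _ := GRing.Zmodule_isComNzRing.Build Zp
  padic_int_mulA padic_int_mulC padic_int_mul1 padic_int_mulD
  padic_int_one_neq0.

Definition padic_int_unit : {pred Zp} := [pred u | `[< exists v, v * u = 1 >]].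
Definition padic_int_inv u : Zp :=
  if pselect (exists v, v * u = 1) is left ex then projT1 (cid ex) else u.

Lemma padic_int_mulV : {in padic_int_unit, left_inverse 1 padic_int_inv *%R}.
Proof.
move=> u /asboolP ex; rewrite /padic_int_inv.
by case: pselect => // ex'; case: cid.
Qed.

Lemma padic_int_unitP u v : v * u = 1 -> padic_int_unit u.
Proof. by move=> vu; apply/asboolP; exists v. Qed.

Lemma padic_int_inv_out : {in [predC padic_int_unit], padic_int_inv =1 id}.
Proof.
move=> u /asboolPn nex; rewrite /padic_int_inv.
by case: pselect.
Qed.

HB.instance Definition _ := GRing.ComNzRing_hasMulInverse.Build Zp
  padic_int_mulV padic_int_unitP padic_int_inv_out.

Let residues_le u m n : (u (m + n)%N %% (p ^ n)%N)%Z = u n.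
Proof.
elim: m => [|m IHm]; first exact: residues_mod.
by rewrite -IHm -[u (m + n)%N]residuesS mod_mod addSn.
Qed.

Lemma padic_int_integral : GRing.integral_domain_axiom Zp.
Proof.
move=> u v uv0; have [//|u_neq0 /=] := eqVneq u 0.
have [m um] : exists m, u m != 0.
  apply: contrapT => /forallNP u0; case/eqP: u_neq0; apply: residues_ext => n /=.
  by rewrite mod0z; apply/eqP/negPn/negP/u0.
apply/eqP/residues_ext => n; rewrite -(residues_le v m n) [RHS]/= mod0z.
set k := (m + n)%N.
have : ((p ^ k)%N %| u k * v k)%Z.
  move/(congr1 (fun w : Zp => w k)): uv0 => /= uvk.
  by apply/dvdz_mod0P; rewrite uvk mod0z.
have {um} : ~~ ((p ^ m)%N %| u k)%Z.
  apply: contra um => /dvdz_mod0P.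
  by rewrite /k addnC residues_le => ->.
move=> Npu puv; apply/dvdz_mod0P; move: Npu puv.
rewrite !dvdzE abszM /=.
have [->|v_gt0] := posnP `|v k|%N; first by rewrite dvdn0.
have [->|u_gt0] := posnP `|u k|%N; first by rewrite dvdn0.
rewrite !pfactor_dvdn ?muln_gt0 ?u_gt0 // lognM // -ltnNge => lt_um le_k.
rewrite -(leq_add2l (logn p `|u k|)) (leq_trans _ le_k) // leq_add2r.
exact: ltnW.
Qed.

HB.instance Definition _ :=
  GRing.ComUnitRing_isIntegral.Build Zp padic_int_integral.

End PadicIntRing.

Definition padic (p : nat) (p_pr : prime p) : fieldType :=
  {fraction padic_int p_pr}.

Section RingOfIntegers.
Variables (p : nat) (p_pr : prime p) (K : fieldExtType (padic p_pr)).

(* The map Z_p -> Q_p -> K; the ring of integers of K is the integral closure  *)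
(* of its image.                                                               *)
Definition padic_int_in : padic_int p_pr -> K :=
  in_alg K \o @tofrac (padic_int p_pr).
HB.instance Definition _ := GRing.RMorphism.on padic_int_in.

Definition integral_pred : {pred K} :=
  [pred x | `[< integralOver padic_int_in x >]].

Record ring_of_integers := RingOfIntegers {
  int_val :> K;
  int_valP : int_val \in integral_pred }.

HB.instance Definition _ := [isSub for int_val].
HB.instance Definition _ := [Choice of ring_of_integers by <:].

Lemma integral_pred_subring : subring_closed integral_pred.
Proof.
split=> [|x y /asboolP ix /asboolP iy|x y /asboolP ix /asboolP iy];
  apply/asboolP.
- exact: integral1.
- exact: integral_sub.
- exact: integral_mul.
Qed.

HB.instance Definition _ :=
  GRing.isSubringClosed.Build K integral_pred integral_pred_subring.
HB.instance Definition _ :=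
  [SubChoice_isSubComNzRing of ring_of_integers by <:].
HB.instance Definition _ := isPointed.Build ring_of_integers 0.

Local Notation O := ring_of_integers.

(* The maximal ideal of the local ring O is its set of nonunits, so F is the   *)
(* residue field of O as soon as it is the quotient of O by the latter.        *)
Definition is_residue_field (F : fieldType) : Prop :=
  exists pi : {rmorphism O -> F},
    (forall y, exists x, pi x = y) /\
    (forall x, pi x = 0 <-> ~ exists y, x * y = 1).

(* The topology of O as a subspace of K is the p-adic one: the ideals p^n O    *)
(* form a basis of neighborhoods of 0.                                         *)
Definition padic_open : set (set O) :=
  [set U | forall x, U x -> exists n, forall y, U (x + (p ^ n)%:R * y)].

Lemma padic_openT : padic_open setT.
Proof. by move=> x _; exists 0%N. Qed.

Lemma padic_openI : setI_closed padic_open.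
Proof.
move=> U V oU oV x [/oU[m Um] /oV[n Vn]]; exists (m + n)%N => y; split.
- by rewrite expnD natrM -mulrA; exact: Um.
- by rewrite expnD mulnC natrM -mulrA; exact: Vn.
Qed.

Lemma padic_open_bigcup (I : Type) (U : I -> set O) :
  (forall i, padic_open (U i)) -> padic_open (\bigcup_i U i).
Proof.
by move=> oU x [i _ /oU[n Un]]; exists n => y; exists i.
Qed.

HB.instance Definition _ := isOpenTopological.Build O
  padic_openT padic_openI padic_open_bigcup.

Definition borelO := g_sigma_algebraType (@open O).
HB.instance Definition _ := Measurable.on borelO.

(* As O is a compact metrizable group, Borel probability measures on it are    *)
(* regular, and its normalized Haar measure is the translation-invariant one.  *)
Definition translation_invariant (R : realType) (mu : set borelO -> \bar R) :=
  forall (a : O) (A : set borelO), measurable A ->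
    mu [set (a + x : O) | x in (A : set O)] = mu A.

(* (a0, a1) is identified with X^2 + a1 X + a0. *)
Definition quad (a : borelO * borelO) : {poly O} :=
  'X^2 + (a.2 : O) *: 'X + (a.1 : O)%:P.

Definition quadK (a : borelO * borelO) : {poly K} := map_poly int_val (quad a).

Definition P11 : set (borelO * borelO) :=
  [set a | exists g h : {poly O},
     [/\ g \is monic, h \is monic, size g = 2, size h = 2 &
      g != h /\ quad a = g * h]].

Definition P2 : set (borelO * borelO) :=
  [set a | irreducible_poly (quadK a)].

(* Splitting fields of a polynomial are isomorphic over K, so the choice of L  *)
(* is irrelevant.                                                              *)
Definition P_Gal (gT : finGroupType) (G : {group gT}) :
    set (borelO * borelO) :=
  [set a | exists L : splittingFieldType K,
     splittingFieldFor 1%AS (map_poly (in_alg L) (quadK a)) {:L} /\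
     'Gal({:L} / 1%AS) \isog G].

End RingOfIntegers.

Arguments is_residue_field {p p_pr} K F.
Arguments borelO {p p_pr} K.
Arguments translation_invariant {p p_pr K R} mu.
Arguments P11 {p p_pr} K.
Arguments P2 {p p_pr} K.
Arguments P_Gal {p p_pr} K {gT} G.

(* Main.v *)
Require Import Defs.
From HB Require Import structures.
From mathcomp Require Import all_boot all_order all_fingroup all_algebra all_solvable all_field.
From mathcomp Require Import all_classical all_reals all_analysis.
From mathcomp Require Import generic_quotient ring lra.

(* Completing the square, the class of X^2 + a1 X + a0 depends only on        *)
(* whether d = (a1/2)^2 - a0 is a nonzero square, zero, or a nonsquare in O.  *)
(* Since O is local and integrally closed and O/pO is finite, O is a discrete *)
(* valuation ring, with uniformizer t say, and since it is p-adically         *)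
(* complete with odd residue characteristic, t^k u with u a unit is a square  *)
(* iff k is even and the residue of u is a square.  For fixed a1 translation  *)
(* invariance turns the measure of { a0 | d is a nonzero square } into that   *)
(* of the set of negated nonzero squares, a disjoint union over k of (q - 1)  *)
(* / 2 balls of measure q^-(2k + 1); summing the geometric series gives q /   *)
(* (2 (q + 1)).                                                               *)

Set Implicit Arguments.
Unset Strict Implicit.
Unset Printing Implicit Defensive.

Import Order.TTheory GRing.Theory Num.Theory.

Local Open Scope ring_scope.

(** * The p-adic integers *)

(** The structure of O comes from one finiteness fact, [exists_spans_mod_p]: a family of O
    independent modulo p is independent over Q_p, hence no longer than [K : Q_p], and a longest one
    spans O modulo p. So any sequence in O has two terms congruent modulo p ([pigeonhole_mod_p]),
    and p-adic series converge in O ([p_complete]). The pigeonhole yields an element nonzero modulo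
    p that the maximal ideal kills modulo p ([exists_socle_mod_p]); since O is integrally closed,
    this gives a generator t of the maximal ideal ([exists_uniformizer]). Nonzero elements are then
    t^k times a unit ([uniformizer_factor]), and completeness gives Hensel's lemma for squares
    ([hensel_sqrt]).

    As 2 is invertible, a quarter d of the discriminant decides everything: distinct linear factors
    for d a nonzero square ([P11E]), irreducibility for d a nonsquare ([P2E]), and a Galois group of
    order 1 or 2 according to whether d is a square ([P_GalE]). The case d = 0 is null. Balls x +
    t^k O have mass q^-k ([mu_ball_O]), a geometric series measures the negated nonzero squares
    ([mu_neg_nonzero_square]), and Fubini carries this to pairs ([nu_quarter_discr]). *)

Section PadicIntegers.
Variables (p : nat) (p_pr : prime p).
Local Notation Zp := (padic_int p_pr).
Implicit Types (u v w : Zp).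

Lemma padic_int_ext u v : (forall n, u n = v n) -> u = v.
Proof. by move=> uv; apply: val_inj; apply: funext. Qed.

Lemma residuesS u n : (u n.+1 %% (p ^ n)%N)%Z = u n.
Proof. by case: u => u /= /asboolP. Qed.

Lemma residues_mod u n : (u n %% (p ^ n)%N)%Z = u n.
Proof. by rewrite -[in RHS]residuesS -[in LHS]residuesS modz_mod. Qed.

Lemma padic_int_natE (z : nat) n : (z%:R : Zp) n = (z %% (p ^ n)%N)%Z.
Proof.
elim: z => [|z IHz]; first by [].
rewrite -addn1 natrD [LHS]/= IHz modzDml modzDmr.
by rewrite PoszD.
Qed.

Lemma padic_int_intE (z : int) n : (z%:~R : Zp) n = (z %% (p ^ n)%N)%Z.
Proof.
case: z => z; first exact: padic_int_natE.
by rewrite NegzE mulrNz -pmulrn -modzNm -padic_int_natE.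
Qed.

Let modp_exp (z : int) n m : (n <= m)%N ->
  ((z %% (p ^ m)%N)%Z %% (p ^ n)%N)%Z = (z %% (p ^ n)%N)%Z.
Proof.
move=> /subnK <-; rewrite [in RHS](divz_eq z (p ^ (m - n + n))%N).
by rewrite expnD PoszM mulrA modzMDl.
Qed.

Lemma residues_le u n m : (n <= m)%N -> (u m %% (p ^ n)%N)%Z = u n.
Proof.
move=> /subnK <-; elim: (m - n)%N => [|k IHk]; first exact: residues_mod.
by rewrite -IHk -[u (k + n)%N]residuesS modp_exp ?leq_addl.
Qed.

(** Division by p costs one digit: the quotient modulo p^n is read off [u] modulo p^(n+1). *)
Lemma padic_int_dvdp u : u 1%N = 0 -> exists v, u = p%:R * v.
Proof.
move=> u1.
have pu n : (p %| u n.+1)%Z.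
  by apply/dvdz_mod0P; rewrite -[RHS]u1 -(@residues_le u 1%N n.+1)// expn1.
have fP n : ((u n.+2 %/ p)%Z = (u n.+1 %/ p)%Z %[mod (p ^ n)%N])%Z.
  have p0 : (p : int) != 0 by rewrite -lt0n prime_gt0.
  apply/eqP; rewrite eqz_mod_dvd -(dvdz_mul2r p0).
  rewrite mulrBl !divzK// -PoszM -expnSr -eqz_mod_dvd.
  by rewrite residuesS residues_mod.
exists (padic_int_mk p_pr fP); apply: padic_int_ext => n.
rewrite [RHS]/= padic_int_natE modzMml modzMmr mulrC divzK//.
by rewrite residuesS.
Qed.

Lemma padic_int_decomp u : exists z : int, exists v, u = z%:~R + p%:R * v.
Proof.
have [|v uv] := @padic_int_dvdp (u - (u 1%N)%:~R).
  by rewrite /= padic_int_intE modzNm modzDmr subrr mod0z.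
by exists (u 1%N), v; rewrite -uv addrCA subrr addr0.
Qed.

(** Bezout inverts each residue separately; inverses modulo p^n being unique, the chosen ones are
    compatible. *)
Lemma padic_int_unit_residue u : u 1%N != 0 -> exists v, v * u = 1.
Proof.
move=> u1.
have cop n : coprimez (u n) (p ^ n)%N.
  case: n => [|n]; first by rewrite expn0 /coprimez gcdz1.
  rewrite coprimezE /= coprimeXr// coprime_sym prime_coprime//.
  apply: contra u1 => pun; apply/eqP.
  rewrite -(@residues_le u 1%N n.+1)// expn1.
  by apply/dvdz_mod0P; rewrite dvdzE.
have inv n : exists z : int, (z * u n = 1 %[mod (p ^ n)%N])%Z.
  have /eqP := cop n; have [a [b ab]] := Bezoutz (u n) (p ^ n)%N.
  rewrite -ab => ab1; exists a.
  apply/eqP; rewrite -ab1 eqz_mod_dvd opprD addrA subrr add0r.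
  by rewrite rpredN dvdz_mull.
have [f fE] := choice inv.
have fP n : (f n.+1 = f n %[mod (p ^ n)%N])%Z.
  have e : (f n.+1 * u n = 1 %[mod (p ^ n)%N])%Z.
    rewrite -(residuesS u n) modzMmr -(@modp_exp (_ * _) n n.+1)//.
    by rewrite fE modp_exp.
  transitivity ((f n.+1 * (f n * u n)) %% (p ^ n)%N)%Z.
    by rewrite -modzMmr fE modzMmr mulr1.
  by rewrite mulrCA -modzMmr e modzMmr mulr1.
exists (padic_int_mk p_pr fP); apply: padic_int_ext => n /=.
by rewrite modzMml fE.
Qed.

Lemma padic_int_sepz u : (forall n, exists v, u = p%:R ^+ n * v) -> u = 0.
Proof.
move=> uP; apply: padic_int_ext => n; have [v ->] := uP n.
by rewrite [RHS]/= mod0z -natrX [LHS]/= padic_int_natE modzz mul0r mod0z.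
Qed.

Lemma padic_int_natp_neq0 : p%:R != 0 :> Zp.
Proof.
apply/eqP => /(congr1 (fun u : Zp => u 2%N)).
rewrite padic_int_natE /= mod0z modz_small.
  by case=> p0; have := prime_gt0 p_pr; rewrite p0.
by rewrite ltz_nat -mulnn ltn_Pmulr ?prime_gt1 ?prime_gt0.
Qed.

Lemma padic_int_sumP (c : nat -> int) n :
  (\sum_(j < n.+1) c j * (p ^ j)%N%:Z = \sum_(j < n) c j * (p ^ j)%N%:Z
    %[mod (p ^ n)%N])%Z.
Proof. by rewrite big_ord_recr /= addrC modzMDl. Qed.

(** The p-adic limit of the series with terms c_j p^j; the digits c_j may be arbitrary integers. *)
Definition padic_int_sum (c : nat -> int) : Zp :=
  padic_int_mk p_pr (padic_int_sumP c).

Lemma padic_int_sum_recl (c : nat -> int) :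
  padic_int_sum c = (c 0%N)%:~R + p%:R * padic_int_sum (c \o succn).
Proof.
apply: padic_int_ext => n /=.
rewrite padic_int_intE padic_int_natE modzMml modzMmr modzDml modzDmr.
rewrite -(padic_int_sumP c) big_ord_recl /= expn0 mulr1 mulr_sumr.
congr (modz (_ + _) _); apply: eq_bigr => i _.
by rewrite /bump /= expnS PoszM mulrCA.
Qed.

End PadicIntegers.

(** * Modules spanned modulo p *)

Lemma pigeonhole_nat (T : finType) (f : nat -> T) :
  exists i j, (i < j)%N /\ f i = f j.
Proof.
have /injectivePn[i [j ij fij]] : ~~ injectiveb (fun i : 'I_#|T|.+1 => f i).
  by apply/injectiveP => /leq_card; rewrite card_ord ltnn.
have [lt|lt|/val_inj e] := ltngtP i j; first by exists i, j.
  by exists j, i.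
by rewrite e eqxx in ij.
Qed.

Section FiniteModP.
Variables (p : nat) (p_pr : prime p) (A : comNzRingType).
Variable iota : {rmorphism padic_int p_pr -> A}.

Definition spans_mod_p n (e : 'I_n -> A) := forall x,
  exists (c : 'I_n -> int) y, x = \sum_i (c i)%:~R * e i + p%:R * y.

Variables (n : nat) (e : 'I_n -> A) (eP : spans_mod_p e).

Lemma pigeonhole_mod_p (y : nat -> A) :
  exists i j z, (i < j)%N /\ y i - y j = p%:R * z.
Proof.
have [c cP] := choice (fun k => eP (y k)).
pose f k : {ffun 'I_n -> 'I_p.+1} := [ffun i => inord `|(c k i %% p)%Z|%N].
have [i [j [ij fij]]] := pigeonhole_nat f.
have p0 : (p : int) != 0 by rewrite -lt0n prime_gt0.
have modc k l : (c k l %% p)%Z = f k l :> int.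
  have pp : (0 < p)%N := prime_gt0 p_pr.
  rewrite ffunE inordK ?gez0_abs ?modz_ge0//.
  by rewrite ltnS -lez_nat gez0_abs ?modz_ge0// ltW// ltz_pmod.
have cE l : exists d : int, c i l - c j l = p%:Z * d.
  have : (p %| c i l - c j l)%Z by rewrite -eqz_mod_dvd !modc fij.
  by move=> /dvdzP[d ->]; exists d; rewrite mulrC.
have [d dE] := choice cE.
have [zi Ei] := cP i; have [zj Ej] := cP j.
exists i, j, (\sum_l (d l)%:~R * e l + zi - zj); split=> //.
rewrite Ei Ej mulrBr mulrDr mulr_sumr opprD addrACA addrA -sumrB.
congr (_ + _ - _).
by apply: eq_bigr => l _; rewrite -mulrBl -rmorphB /= dE rmorphM /= mulrA.
Qed.

(** Expand the series on the spanning family with carries: r_0 = 0 and r_k + y_k = sum_i d_ik e_i +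
    p r_(k+1). The limit is then the sum of the e_i weighted by the p-adic integers with digits
    d_ik, and the carry r_k only enters the tail. *)
Lemma p_complete (y : nat -> A) :
  exists L, forall k, exists z,
    L = \sum_(j < k) p%:R ^+ j * y j + p%:R ^+ k * z.
Proof.
have [c cP] := choice eP; have [Y YP] := choice cP.
pose fix r k := if k is k'.+1 then Y (r k' + y k') else 0.
pose d i k := c (r k + y k) i.
pose S i k := iota (padic_int_sum p_pr (fun j => d i (k + j)%N)).
have SE i k : S i k = (d i k)%:~R + p%:R * S i k.+1.
  rewrite /S padic_int_sum_recl rmorphD rmorphM rmorph_int rmorph_nat addn0.
  by congr (_ + _ * iota (padic_int_sum _ _)); apply/funext => j /=;
    rewrite addnS addSn.
exists (\sum_i S i 0%N * e i) => k; exists (\sum_i S i k * e i - r k).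
elim: k => [|k IHk]; first by rewrite big_ord0 add0r expr0 mul1r subr0.
rewrite IHk big_ord_recr -!addrA/=; congr (_ + _).
have := YP (r k + y k); rewrite -/(r k.+1) => rE.
rewrite exprSr -mulrA -mulrDr; congr (_ * _).
rewrite mulrBr mulr_sumr.
have -> : \sum_i S i k * e i =
    \sum_i (d i k)%:~R * e i + \sum_i p%:R * (S i k.+1 * e i).
  by rewrite -big_split; apply: eq_bigr => i _; rewrite /= mulrA -mulrDl SE.
have -> : \sum_i (d i k)%:~R * e i = r k + y k - p%:R * r k.+1.
  by rewrite rE addrK.
ring.
Qed.

End FiniteModP.

(** * The ring of integers is spanned modulo p by finitely many elements *)

Lemma fraction_numden (R : idomainType) (x : {fraction R}) :
  exists a b : R, b != 0 /\ tofrac b * x = tofrac a.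
Proof.
elim/quotW: x => x; exists (frac x).1, (frac x).2; split;
  first exact: denom_ratioP.
rewrite -[_ * _]/(FracField.mul _ _) !piE.
apply/eqmodP => /=; rewrite FracField.equivfE /FracField.mulf.
by rewrite !numden_Ratio ?mulr1 ?mul1r ?oner_neq0 ?denom_ratioP// mulrC.
Qed.

Section IntegersOfK.
Variables (p : nat) (p_pr : prime p) (K : fieldExtType (padic p_pr)).
Local Notation Zp := (padic_int p_pr).
Local Notation O := (ring_of_integers K).
Local Notation val := (@int_val _ _ K).

HB.instance Definition _ := GRing.RMorphism.copy val (\val : O -> K).

Lemma int_val_inj : injective val.
Proof. exact: val_inj. Qed.

Definition padic_int_to (u : Zp) : O :=
  RingOfIntegers (introT (asboolP _) (integral_id (padic_int_in K) u)).

Fact padic_int_to_zmod : zmod_morphism padic_int_to.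
Proof. by move=> u v; apply: int_val_inj; rewrite /= !rmorphB. Qed.

Fact padic_int_to_monoid : monoid_morphism padic_int_to.
Proof.
by split=> [|u v]; apply: int_val_inj; rewrite /= (rmorph1, rmorphM).
Qed.

HB.instance Definition _ :=
  GRing.isZmodMorphism.Build Zp O padic_int_to padic_int_to_zmod.
HB.instance Definition _ :=
  GRing.isMonoidMorphism.Build Zp O padic_int_to padic_int_to_monoid.

Lemma padic_int_in_inj : injective (padic_int_in K).
Proof.
move=> u v /fmorph_inj/eqP; rewrite -subr_eq0 -rmorphB tofrac_eq0 subr_eq0.
by move/eqP.
Qed.

Lemma padic_int_to_inj : injective padic_int_to.
Proof. by move=> u v /(congr1 val) /padic_int_in_inj. Qed.

Lemma ring_of_integers_closed (x : K) :
  integralOver val x -> exists y : O, val y = x.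
Proof.
case=> P monP rootP.
suff /asboolP xO : integralOver (padic_int_in K) x.
  by exists (@RingOfIntegers _ _ K x xO).
apply: (@integral_root_monic _ _ _ _ (map_poly val P)).
- exact: monic_map.
- exact: rootP.
- apply/integral_poly => i; rewrite coef_map.
  by apply/asboolP; exact: int_valP.
Qed.

Lemma ring_of_integers_mulf_eq0 (x y : O) : x * y = 0 -> x = 0 \/ y = 0.
Proof.
move=> /(congr1 val)/eqP; rewrite rmorphM rmorph0 mulf_eq0.
by case/orP=> /eqP xy0; [left|right]; apply: int_val_inj; rewrite xy0 rmorph0.
Qed.

Lemma ring_of_integers_mulfI (x y z : O) : x != 0 -> x * y = x * z -> y = z.
Proof.
move=> /eqP x0 /eqP; rewrite -subr_eq0 -mulrBr => /eqP.
by case/ring_of_integers_mulf_eq0 => // /eqP; rewrite subr_eq0 => /eqP.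
Qed.

Lemma ring_of_integers_natp_neq0 : p%:R != 0 :> O.
Proof.
rewrite -(rmorph_nat padic_int_to) -(rmorph0 padic_int_to).
by rewrite (inj_eq padic_int_to_inj) padic_int_natp_neq0.
Qed.

Definition free_mod_p n (e : 'I_n -> O) := forall (c : 'I_n -> int) (y : O),
  \sum_i (c i)%:~R * e i = p%:R * y -> forall i, (p %| c i)%Z.

(** Descent: the coefficients of a relation are all divisible by p, and as O has no p-torsion,
    dividing them by p leaves a relation. So every p^N divides them. *)
Lemma free_mod_p_free n (e : 'I_n -> O) (l : 'I_n -> Zp) :
  free_mod_p e -> \sum_i padic_int_to (l i) * e i = 0 -> forall i, l i = 0.
Proof.
move=> eF le0 i; apply: padic_int_sepz => N.
elim: N l le0 i => [|N IHN] l le0 i.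
  by exists (l i); rewrite mul1r.
have [c cP] := choice (fun j => padic_int_decomp (l j)).
have [v lE] := choice cP.
have /eF cp :
    \sum_j (c j)%:~R * e j = p%:R * (- \sum_j padic_int_to (v j) * e j).
  apply/eqP; rewrite mulrN mulr_sumr -addr_eq0 -big_split -[X in _ == X]le0.
  apply/eqP/eq_bigr => j _.
  by rewrite lE rmorphD rmorphM rmorph_int rmorph_nat mulrDl mulrA.
have [d dE] := choice (fun j => elimT dvdzP (cp j)).
have lpE j : l j = p%:R * ((d j)%:~R + v j).
  by rewrite lE dE rmorphM /= mulrDr [in RHS]mulrC.
have [|w wE] := IHN (fun j => (d j)%:~R + v j) _ i.
  apply: (ring_of_integers_mulfI ring_of_integers_natp_neq0).
  rewrite mulr0 mulr_sumr -[RHS]le0; apply: eq_bigr => j _.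
  by rewrite [in RHS]lpE [in RHS]rmorphM rmorph_nat mulrA.
by exists w; rewrite lpE wE exprS mulrA.
Qed.

Lemma padic_common_denominator n (k : 'I_n -> padic p_pr) :
  exists2 d : Zp, d != 0 & exists l : 'I_n -> Zp, forall i,
    tofrac d * k i = tofrac (l i).
Proof.
have frac (x : padic p_pr) :
    exists ab : Zp * Zp, ab.2 != 0 /\ tofrac ab.2 * x = tofrac ab.1.
  by have [a [b abx]] := fraction_numden x; exists (a, b).
have [ab abP] := choice (fun i => frac (k i)).
exists (\prod_i (ab i).2).
  by apply/prodf_neq0 => i _; case: (abP i).
exists (fun i => (\prod_(j | j != i) (ab j).2) * (ab i).1) => i.
by rewrite (bigD1 i)//= mulrC !rmorphM/= -(abP i).2 mulrCA mulrA mulrC mulrA.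
Qed.

Lemma free_mod_p_dim n (e : 'I_n -> O) : free_mod_p e -> (n <= \dim {:K})%N.
Proof.
move=> eF.
suff fr : free [tuple val (e i) | i < n].
  have := dimvS (subvf <<[tuple val (e i) | i < n]>>%VS).
  by rewrite (eqnP fr) size_tuple.
apply/freeP => k ke0 i.
have {}ke0 : \sum_j k j *: val (e j) = 0.
  by rewrite -[RHS]ke0; apply: eq_bigr => j _; rewrite -tnth_nth tnth_mktuple.
have [d d0 [l lE]] := padic_common_denominator k.
have l0 : forall i, l i = 0.
  apply: (free_mod_p_free eF); apply: int_val_inj; rewrite rmorph_sum rmorph0.
  have step j : val (padic_int_to (l j) * e j) =
      (tofrac d : padic p_pr) *: (k j *: val (e j)).
    by rewrite rmorphM/= scalerA lE /padic_int_in /= mulr_algl.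
  rewrite (eq_bigr _ (fun j _ => step j)) -scaler_sumr ke0.
  exact: scaler0.
have /eqP := lE i; rewrite l0 rmorph0 mulf_eq0 tofrac_eq0 (negbTE d0) /=.
by move=> /eqP.
Qed.

Lemma exists_spans_mod_p : exists n (e : 'I_n -> O), spans_mod_p p e.
Proof.
pose P n := `[< exists e : 'I_n -> O, free_mod_p e >].
have P0 : exists n, P n.
  by exists 0%N; apply/asboolP; exists (fun _ => 0) => c y _ [].
have Pub n : P n -> (n <= \dim {:K})%N.
  by move=> /asboolP[e]; exact: free_mod_p_dim.
case: (ex_maxnP P0 Pub) => n /asboolP[e eF] nmax.
exists n, e => x; apply: contrapT => nx.
suff : P n.+1 by move=> /nmax; rewrite ltnn.
apply/asboolP; exists (fun i => if unlift ord0 i is Some j then e j else x).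
move=> c y; rewrite big_ord_recl unlift_none.
under eq_bigr do rewrite liftK.
move=> cE.
(* If p divides the coefficient of [x], freeness of [e] handles the other ones; otherwise Bezout
   inverts it modulo p and puts [x] in the span of [e]. *)
have [pc0|npc0] := boolP (p %| c ord0)%Z.
  have [d dE] := dvdzP pc0.
  have cF j : (p %| c (lift ord0 j))%Z.
    apply: (eF (fun j => c (lift ord0 j)) (y - d%:~R * x)).
    move: cE => /(canRL (addKr _)) ->.
    by rewrite dE rmorphM /= -pmulrn; ring.
  move=> i; have [j ->|->//] := unliftP ord0 i; exact: cF.
case: nx.
have /coprimezP[[a b] /= ab] : coprimez p (c ord0).
  by rewrite coprimezE prime_coprime// -dvdzE.
exists (fun j => - b * c (lift ord0 j)), (a%:~R * x + b%:~R * y).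
have ab' : a%:~R * p%:R + b%:~R * (c ord0)%:~R = 1 :> O.
  by rewrite (pmulrn 1 p) -!rmorphM -rmorphD /= ab.
under eq_bigr do rewrite rmorphM /= rmorphN /= -mulrA.
rewrite -mulr_sumr.
move: cE => /(canRL (addKr _)) ->.
transitivity ((a%:~R * p%:R + b%:~R * (c ord0)%:~R) * x).
  by rewrite ab' mul1r.
ring.
Qed.

End IntegersOfK.

(** * The ring of integers is a discrete valuation ring *)

Lemma padic_int_factor (p : nat) (p_pr : prime p) (u : padic_int p_pr) :
  u != 0 -> exists r v w, u = p%:R ^+ r * v /\ w * v = 1.
Proof.
move=> u0; have [N NP] : exists N, ~ exists v, u = p%:R ^+ N * v.
  by apply/existsNP => uP; case/eqP: u0; exact: padic_int_sepz.
elim: N u NP {u0} => [|N IHN] u uN; first by case: uN; exists u; rewrite mul1r.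
have [/padic_int_dvdp[v uE]|/padic_int_unit_residue[w wu]] := eqVneq (u 1%N) 0.
  have [|r [v' [w [vE wv]]]] := IHN v.
    by move=> [v' vE]; apply: uN; exists v'; rewrite uE vE mulrA -exprS.
  by exists r.+1, v', w; split=> //; rewrite uE vE mulrA -exprS.
by exists 0%N, u, w; rewrite mul1r.
Qed.

Section LocalStructure.
Variables (p : nat) (p_pr : prime p) (K : fieldExtType (padic p_pr)).
Local Notation Zp := (padic_int p_pr).
Local Notation O := (ring_of_integers K).
Local Notation val := (@int_val _ _ K).
Local Notation iota := (@padic_int_to _ _ K).
Variables (F : finFieldType) (pi : {rmorphism O -> F}).
Hypothesis pi_eq0 : forall x, pi x = 0 <-> ~ exists y, x * y = 1.

Lemma residue_unit x : pi x != 0 -> exists y, x * y = 1.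
Proof. by move=> /eqP px; apply: contrapT => nx; apply/px/pi_eq0. Qed.

Lemma residue_natp : pi p%:R = 0.
Proof.
have [l l_pr /andP[_ /eqP lF]] := finPcharP F.
have [lp|lp] := eqVneq l p; first by rewrite rmorph_nat -lp.
have [|v vl] := @padic_int_unit_residue p p_pr l%:R.
  rewrite padic_int_natE expn1; apply/negP => /eqP/dvdz_mod0P.
  by rewrite dvdzE /= dvdn_prime2// eq_sym (negbTE lp).
have : pi l%:R = 0 by rewrite rmorph_nat.
case/pi_eq0; exists (iota v).
by rewrite -(rmorph_nat iota) -rmorphM mulrC vl rmorph1.
Qed.

(** Stripping factors X from an integral equation of [x] leaves an equation with nonzero constant
    term, and that term is a multiple of [x]. *)
Lemma divides_padic_int (x : O) : x != 0 ->
  exists c w, c != 0 /\ iota c = x * w.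
Proof.
move=> x0.
have /asboolP[P monP rootP] := int_valP x.
have {rootP} : (map_poly iota P).[x] = 0.
  apply: int_val_inj; rewrite rmorph0 -horner_map -map_poly_comp.
  by apply/eqP; exact: rootP.
have : P != 0 by rewrite monic_neq0.
elim/poly_ind: P {monP} => [|P c IHP]; first by rewrite eqxx.
rewrite rmorphD rmorphM /= map_polyX map_polyC /= !hornerE.
have [->|c0 _] := eqVneq c 0.
  rewrite polyC0 addr0 rmorph0 addr0 => PX0 /ring_of_integers_mulf_eq0.
  case=> [|x_eq0]; last by rewrite x_eq0 eqxx in x0.
  by apply: IHP; apply: contra PX0 => /eqP ->; rewrite mul0r.
move/eqP; rewrite addr_eq0 => /eqP Px.
by exists c, (- (map_poly iota P).[x]); rewrite mulrN mulrC Px opprK.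
Qed.

(** A nonzero [x] divides some p^r times a unit, so [x] in p^(r+1) O would make p invertible. *)
Lemma p_adic_sep (x : O) : (forall k, exists z, x = p%:R ^+ k * z) -> x = 0.
Proof.
move=> xP; apply/eqP/negPn/negP => /divides_padic_int[c [w [c0 cE]]].
have [r [v [v' [cE' v'v]]]] := padic_int_factor c0.
have [z xE] := xP r.+1.
have /pi_eq0[] := residue_natp; exists (z * w * iota v').
have := ring_of_integers_natp_neq0 K => /eqP p0.
have pr0 : p%:R ^+ r != 0 :> O.
  elim: r {cE' xE} => [|r IHr]; first by rewrite oner_neq0.
  rewrite exprS; apply/eqP => /ring_of_integers_mulf_eq0[//|/eqP].
  by rewrite (negbTE IHr).
apply: (ring_of_integers_mulfI pr0); rewrite !mulrA -exprSr -xE -cE cE' mulr1.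
rewrite rmorphM rmorphXn rmorph_nat -mulrA -rmorphM.
by rewrite [v * v']mulrC v'v rmorph1 mulr1.
Qed.

Lemma ring_of_integers_pigeonhole (y : nat -> O) :
  exists i j z, (i < j)%N /\ y i - y j = p%:R * z.
Proof.
have [n [e eP]] := exists_spans_mod_p K.
exact: (pigeonhole_mod_p p_pr eP).
Qed.

(** Otherwise, starting from 1, one could multiply by elements of the maximal ideal forever without
    entering pO. Two of the products agree modulo p, that is, b_i (1 - y) is in pO with y in the
    maximal ideal; but 1 - y is a unit. *)
Lemma exists_socle_mod_p : exists b : O, (~ exists z, b = p%:R * z) /\
  forall y, pi y = 0 -> exists z, y * b = p%:R * z.
Proof.
apply: contrapT => nb.
have step (b : O) : exists y, (exists z, b = p%:R * z) \/
    pi y = 0 /\ ~ exists z, y * b = p%:R * z.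
  apply: contrapT => ny; apply: nb; exists b; split=> [bp|y py].
    by apply: ny; exists 0; left.
  by apply: contrapT => nyb; apply: ny; exists y; right.
have [f fP] := choice step.
pose fix b k := if k is k'.+1 then f (b k') * b k' else 1.
have bP k : ~ exists z, b k = p%:R * z.
  elim: k => [|k IHk] /=.
    case=> z pz; have /pi_eq0 := residue_natp; apply.
    by exists z; rewrite -pz.
  by have [//|[]] := fP (b k).
have fm k : pi (f (b k)) = 0 by have [/bP//|[]] := fP (b k).
have bD i k : exists y, pi y = 0 /\ b (i + k.+1)%N = y * b i.
  elim: k => [|k [y [py bE]]]; first by exists (f (b i)); rewrite addn1.
  exists (f (b (i + k.+1)%N) * y); rewrite rmorphM py mulr0; split=> //.
  by rewrite addnS /= bE mulrA.
have [i [j [z [ij bE]]]] := ring_of_integers_pigeonhole b.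
have [y [py bjE]] := bD i (j - i.+1)%N.
have [|u uE] := @residue_unit (1 - y).
  by rewrite rmorphB rmorph1 py subr0 oner_neq0.
apply: (bP i); exists (u * z).
rewrite mulrCA -bE -(subnKC ij) addSnnS bjE.
by rewrite -[LHS]mul1r -uE; ring.
Qed.

(* If no [t] with [t x = 1] existed in the maximal ideal for [x = b / p],     *)
(* then [O[x]] would lie in [p^-1 O], so that two powers of [x] would be      *)
(* congruent modulo [O] and [x] would be integral.                            *)
Lemma exists_uniformizer : exists t : O, [/\ t != 0, pi t = 0,
  (forall y, pi y = 0 -> exists z, y = t * z) &
  (exists N z, t ^+ N = p%:R * z)].
Proof.
have p0 := ring_of_integers_natp_neq0 K.
have [b [bNp bm]] := exists_socle_mod_p.
have b0 : b != 0 by apply/eqP => b0; apply: bNp; exists 0; rewrite b0 mulr0.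
have [t [pt tb]] : exists t, pi t = 0 /\ t * b = p%:R.
  apply: contrapT => nt.
  have zP y : exists z, pi y = 0 -> y * b = p%:R * z /\ pi z = 0.
    have [py|py] := eqVneq (pi y) 0; last first.
      by exists 0 => py0; rewrite py0 eqxx in py.
    have [z zE] := bm y py; exists z => _; split=> //.
    apply/eqP/negPn/negP => /residue_unit[u zu]; apply: nt; exists (y * u).
    by rewrite rmorphM py mul0r mulrAC zE -mulrA zu mulr1.
  have [g gP] := choice zP.
  (* [B k] is x^k p; it stays in the maximal ideal because a unit quotient would provide [t]. *)
  pose B k := iter k g p%:R.
  have pB k : pi (B k) = 0.
    by elim: k => [|k IHk] /=; [exact: residue_natp|have [] := gP _ IHk].
  have vp0 : val p%:R != 0.
    by apply: contra p0 => /eqP vp; apply/eqP/int_val_inj; rewrite vp rmorph0.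
  pose x := val b / val p%:R.
  have xp : x * val p%:R = val b by rewrite divfK.
  have BE k : val (B k) = x ^+ k * val p%:R.
    elim: k => [|k IHk]; first by rewrite mul1r.
    apply: (mulfI vp0); have [BbE _] := gP _ (pB k).
    have BbE' : val (B k) * val b = val p%:R * val (B k.+1).
      by rewrite -!rmorphM BbE.
    by rewrite -BbE' IHk exprS -xp; ring.
  have [i [j [z [ij BBE]]]] := ring_of_integers_pigeonhole B.
  have xij : x ^+ i - x ^+ j = val z.
    apply: (mulIf vp0); rewrite mulrBl -!BE -rmorphB BBE rmorphM.
    exact: mulrC.
  have [|y xE] := @ring_of_integers_closed _ _ K x.
    exists ('X^j + (z%:P - 'X^i)).
      rewrite monicE lead_coefDl ?lead_coefXn// size_polyXn ltnS.
      rewrite (leq_trans (size_polyD _ _))// geq_max size_polyN size_polyXn ij.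
      by rewrite (leq_trans (size_polyC_leq1 _))// (leq_trans _ ij).
    rewrite /root rmorphD rmorphB /= !map_polyXn map_polyC !hornerE.
    by rewrite /= -xij; apply/eqP; ring.
  apply: bNp; exists y; apply: int_val_inj; by rewrite rmorphM /= xE mulrC xp.
(* By choice of [b], y b is a multiple of p = t b; cancel [b]. *)
have mt y : pi y = 0 -> exists z, y = t * z.
  move=> /bm[z]; rewrite -tb => yb; exists z.
  by apply: (ring_of_integers_mulfI b0); rewrite mulrC yb; ring.
exists t; split=> //; first by apply/eqP => t0; rewrite -tb t0 mul0r eqxx in p0.
(* Two powers of [t] agree modulo p: t^i (1 - t^(j-i)) is in pO, and the second factor is a unit. *)
have [i [j [z [ij tE]]]] := ring_of_integers_pigeonhole (GRing.exp t).
have [|u uE] := @residue_unit (1 - t ^+ (j - i)).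
  rewrite rmorphB rmorph1 rmorphXn pt expr0n subn_eq0 leqNgt ij subr0.
  exact: oner_neq0.
exists i, (z * u); rewrite mulrA -tE -[in X in _ - X](subnKC (ltnW ij)) exprD.
by rewrite -[X in X - _]mulr1 -mulrBr -mulrA uE mulr1.
Qed.

End LocalStructure.

(** * Factorization by a uniformizer and Hensel's lemma for square roots *)

Section Uniformizer.
Variables (p : nat) (p_pr : prime p) (K : fieldExtType (padic p_pr)).
Local Notation O := (ring_of_integers K).
Variables (F : finFieldType) (pi : {rmorphism O -> F}).
Hypothesis pi_eq0 : forall x, pi x = 0 <-> ~ exists y, x * y = 1.
Variable t : O.
Hypothesis t_neq0 : t != 0.
Hypothesis pi_t : pi t = 0.
Hypothesis t_max : forall y, pi y = 0 -> exists z, y = t * z.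
Hypothesis t_nilp : exists N z, t ^+ N = p%:R * z.

Lemma uniformizer_exp_neq0 k : t ^+ k != 0.
Proof.
elim: k => [|k IHr]; first by rewrite oner_neq0.
rewrite exprS; apply/eqP => /ring_of_integers_mulf_eq0[|] /eqP.
  by rewrite (negbTE t_neq0).
by rewrite (negbTE IHr).
Qed.

Lemma uniformizer_sep x : (forall k, exists z, x = t ^+ k * z) -> x = 0.
Proof.
move=> xP; apply: (p_adic_sep pi_eq0) => k.
have [N [y tN]] := t_nilp; have [z ->] := xP (N * k)%N.
by exists (y ^+ k * z); rewrite exprM tN exprMn mulrA.
Qed.

Lemma uniformizer_factor x : x != 0 -> exists k u, x = t ^+ k * u /\ pi u != 0.
Proof.
move=> x0; have [N NP] : exists N, ~ exists z, x = t ^+ N * z.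
  by apply/existsNP => xP; case/eqP: x0; exact: uniformizer_sep.
elim: N x NP {x0} => [|N IHN] x xN; first by case: xN; exists x; rewrite mul1r.
have [/t_max[v xE]|px] := eqVneq (pi x) 0; last by exists 0%N, x; rewrite mul1r.
have [|r [u [vE pu]]] := IHN v.
  by move=> [z vE]; apply: xN; exists z; rewrite xE vE mulrA -exprS.
by exists r.+1, u; split=> //; rewrite xE vE mulrA -exprS.
Qed.

Hypothesis p_gt2 : (2 < p)%N.

Lemma exists_half : exists h : O, 2 * h = 1.
Proof.
have [|v v2] := @padic_int_unit_residue p p_pr 2%:R.
  by rewrite padic_int_natE expn1 modz_nat modn_small.
exists (padic_int_to K v).
by rewrite -(rmorph_nat (padic_int_to K)) -rmorphM mulrC v2 rmorph1.
Qed.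

(* Newton's iteration for the square root of a unit congruent to 1, with the  *)
(* derivative frozen at its value 2 at 1.                                     *)
Lemma sqrt_principal_unit u : pi u = 1 -> exists w, w ^+ 2 = u.
Proof.
move=> pu; have [h h2] := exists_half.
pose w k := iter k (fun w => w - h * (w ^+ 2 - u)) 1.
have w1 k : exists z, 1 - w k = t * z.
  have pw : pi (w k) = 1.
    elim: k => [|k IHk] /=; first by rewrite rmorph1.
    rewrite rmorphB rmorphM rmorphB rmorphXn /= IHk pu expr1n subrr.
    by rewrite mulr0 subr0.
  by apply: t_max; rewrite rmorphB rmorph1 pw subrr.
have wu k : exists z, w k ^+ 2 - u = t ^+ k.+1 * z.
  elim: k => [|k [z wE]].
    rewrite expr1; apply: t_max.
    by rewrite rmorphB rmorphXn /= rmorph1 expr1n pu subrr.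
  have [y yE] := w1 k; exists (y * z + h ^+ 2 * t ^+ k * z ^+ 2).
  rewrite -[w k.+1]/(w k - h * (w k ^+ 2 - u)) wE.
  (* For e = w^2 - u the next error is e (1 - w) + h^2 e^2, because 2 h = 1; as [t] divides both 1 -
     w and e, a factor [t] is gained. *)
  transitivity ((w k ^+ 2 - u) - (2 * h) * w k * (t ^+ k.+1 * z)
      + h ^+ 2 * (t ^+ k.+1 * z) ^+ 2); first by ring.
  rewrite h2 wE mul1r; transitivity (t ^+ k.+1 * z * (1 - w k)
      + h ^+ 2 * (t ^+ k.+1 * z) ^+ 2); first by ring.
  rewrite yE 2![in RHS]exprS 2![in LHS]exprS; ring.
have wD k d : exists z, w (k + d)%N = w k + t ^+ k * z.
  elim: d => [|d [z wE]]; first by exists 0; rewrite addn0 mulr0 addr0.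
  have [y yE] := wu (k + d)%N.
  exists (z - h * t ^+ d.+1 * y); rewrite addnS.
  rewrite -[w (k + d).+1]/(w (k + d)%N - h * (w (k + d)%N ^+ 2 - u)) yE wE.
  rewrite -addnS exprD; ring.
(* Along the indices N k the increments are multiples of p^k, so [p_complete] supplies the limit. *)
have [N [s tN]] := t_nilp.
have tNk k : t ^+ (N * k) = p%:R ^+ k * s ^+ k by rewrite exprM tN exprMn.
have step k : exists y, w (N * k.+1)%N = w (N * k)%N + p%:R ^+ k * y.
  have [z zE] := wD (N * k)%N N.
  by exists (s ^+ k * z); rewrite mulnS addnC zE tNk mulrA.
have [y yE] := choice step.
have [n [e eP]] := exists_spans_mod_p K.
have [L LP] := p_complete (padic_int_to K) eP y.
have sumE k : \sum_(j < k) p%:R ^+ j * y j = w (N * k)%N - 1.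
  elim: k => [|k IHk]; first by rewrite big_ord0 muln0 subrr.
  by rewrite big_ord_recr /= IHk yE addrAC.
exists (L + 1); apply/eqP; rewrite -subr_eq0; apply/eqP.
apply: (p_adic_sep pi_eq0) => k.
have [z ->] := LP k; have [z' z'E] := wu (N * k)%N.
rewrite sumE.
exists (s ^+ k * t * z' + 2 * w (N * k)%N * z + p%:R ^+ k * z ^+ 2).
transitivity ((w (N * k)%N ^+ 2 - u) +
    p%:R ^+ k * (2 * w (N * k)%N * z + p%:R ^+ k * z ^+ 2)).
  by ring.
rewrite z'E exprSr tNk; ring.
Qed.

(** Dividing by the square of a lift of [f] reduces to a unit of residue 1. *)
Lemma hensel_sqrt x f : f != 0 -> pi x = f ^+ 2 ->
  (forall g, exists y, pi y = g) -> exists w, w ^+ 2 = x.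
Proof.
move=> f0 px pi_surj; have [g gf] := pi_surj f.
have [|v gv] := residue_unit pi_eq0 (x := g); first by rewrite gf.
have fv : f * pi v = 1 by rewrite -gf -rmorphM gv rmorph1.
have [|w wE] := @sqrt_principal_unit (x * v ^+ 2).
  by rewrite rmorphM rmorphXn px -exprMn fv expr1n.
exists (w * g); rewrite exprMn wE -mulrA -exprMn [v * g]mulrC gv expr1n.
by rewrite mulr1.
Qed.

End Uniformizer.

(** * Squares *)

(** The sign comes from d = c - a0: up to translation, a0 runs over negated squares. *)
Definition neg_square (F : finFieldType) : pred F :=
  [pred f | (f != 0) && [exists g, - f == g ^+ 2]].

(** The map g -> - g^2 is two-to-one from the nonzero elements onto [neg_square], with fibres {g,
    -g}. *)
Lemma card_neg_square (F : finFieldType) : (2 : F) != 0 ->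
  #|F| = (2 * #|@neg_square F|).+1%N.
Proof.
move=> F2; rewrite -[LHS]prednK ?(ltnW (finNzRing_gt1 F))// -(cardC1 (0 : F)).
congr _.+1.
rewrite -sum1_card.
rewrite (partition_big (fun g : F => - g ^+ 2) (@neg_square F))/=; last first.
  move=> g; rewrite !inE => g0; rewrite /neg_square /= oppr_eq0 expf_eq0 g0 /=.
  by apply/existsP; exists g; rewrite opprK.
rewrite mulnC -sum_nat_const; apply: eq_bigr => f /andP[f0 /existsP[g /eqP fg]].
have g0 : g != 0.
  by apply: contra f0 => /eqP g0; rewrite -oppr_eq0 fg g0 expr0n.
transitivity #|[set g; - g]%SET|; last first.
  rewrite cards2 -subr_eq0 opprK -mulr2n -mulr_natl mulf_eq0.
  by rewrite (negbTE F2) (negbTE g0).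
rewrite -sum1_card; apply: eq_bigl => k; rewrite !inE eqr_oppLR fg eqf_sqr.
by apply: andb_idl => /orP[] /eqP ->; rewrite ?oppr_eq0.
Qed.

Section Squares.
Variables (p : nat) (p_pr : prime p) (K : fieldExtType (padic p_pr)).
Local Notation O := (ring_of_integers K).
Variables (F : finFieldType) (pi : {rmorphism O -> F}).
Hypothesis pi_eq0 : forall x, pi x = 0 <-> ~ exists y, x * y = 1.
Variable t : O.
Hypothesis t_neq0 : t != 0.
Hypothesis pi_t : pi t = 0.
Hypothesis t_max : forall y, pi y = 0 -> exists z, y = t * z.
Hypothesis t_nilp : exists N z, t ^+ N = p%:R * z.
Variable rho : F -> O.
Hypothesis rhoK : cancel rho pi.
Hypothesis p_gt2 : (2 < p)%N.

Local Notation factor := (uniformizer_factor pi_eq0 t_max t_nilp).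

Lemma uniformizer_factor_inj i j u v :
  t ^+ i * u = t ^+ j * v -> pi u != 0 -> pi v != 0 -> i = j /\ u = v.
Proof.
wlog le_ij : i j u v / (i <= j)%N.
  move=> H; have [|lt_ji] := leqP i j; first exact: H.
  by move=> /esym/H E pu pv; have [] := E (ltnW lt_ji) pv pu.
rewrite -(subnKC le_ij) exprD -mulrA.
move=> /(ring_of_integers_mulfI (uniformizer_exp_neq0 t_neq0 i)) ->.
case: (j - i)%N => [|k]; first by rewrite mul1r addn0.
by rewrite rmorphM rmorphXn pi_t /= expr0n mul0r eqxx.
Qed.

Definition nonzero_square (d : O) := exists2 y, y != 0 & d = y ^+ 2.

Definition is_square (d : O) := nonzero_square d \/ d = 0.

Lemma nonzero_squareP d : nonzero_square d <->
  exists k u f, [/\ d = t ^+ (2 * k) * u, f != 0 & pi u = f ^+ 2].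
Proof.
split=> [[y y0 ->]|[k [u [f [-> f0 pu]]]]].
  have [k [v [-> pv]]] := factor y0.
  exists k, (v ^+ 2), (pi v); rewrite exprMn -exprM mulnC; split=> //.
  by rewrite rmorphXn.
have [|w wE] := hensel_sqrt pi_eq0 t_max t_nilp p_gt2 f0 pu.
  by move=> g; exists (rho g).
exists (t ^+ k * w); last by rewrite exprMn wE -exprM mulnC.
apply/eqP => /ring_of_integers_mulf_eq0[/eqP|w0].
  by rewrite (negbTE (uniformizer_exp_neq0 t_neq0 k)).
have /eqP := pu; rewrite -wE w0 expr0n rmorph0 eq_sym expf_eq0 /=.
by rewrite (negbTE f0).
Qed.

(** A perturbation beyond the valuation of [d] changes neither that valuation nor the residue of the
    unit part. *)
Lemma nonzero_square_near d : d != 0 -> exists k, forall s,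
  d + t ^+ k * s != 0 /\ (nonzero_square (d + t ^+ k * s) <-> nonzero_square d).
Proof.
move=> /factor[j [u [-> pu]]]; exists j.+1 => s.
rewrite exprS [t * _]mulrC -mulrA -mulrDr.
have pus : pi (u + t * s) = pi u by rewrite rmorphD rmorphM pi_t mul0r addr0.
split.
  apply/eqP => /ring_of_integers_mulf_eq0[] /eqP.
    by rewrite (negbTE (uniformizer_exp_neq0 t_neq0 j)).
  by move=> /eqP us0; move: pu; rewrite -pus us0 rmorph0 eqxx.
by split=> /nonzero_squareP[k [v [f [vE f0 pv]]]]; apply/nonzero_squareP;
  have [||jk uv] := uniformizer_factor_inj vE; rewrite ?pv ?pus ?expf_neq0//;
  [exists k, u, f|exists k, (u + t * s), f]; rewrite -jk;
  split=> //; rewrite -pv -uv ?pus.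
Qed.

(** Exhibits the negated nonzero squares as a union of balls: the valuation is even, the leading
    digit constrained, the tail free. *)
Lemma neg_nonzero_squareP x : nonzero_square (- x) <->
  exists k f y, neg_square f /\ x =
     t ^+ (2 * k) * rho f + t ^+ (2 * k).+1 * y.
Proof.
split=> [/nonzero_squareP[k [u [f [xE f0 pu]]]]|[k [f [y [/andP[f0]]]]]].
  exists k, (- f ^+ 2).
  have /t_max[y yE] : pi (- u - rho (- f ^+ 2)) = 0.
    by rewrite rmorphB rhoK rmorphN pu opprK addNr.
  exists y; split.
    rewrite /neg_square /= oppr_eq0 expf_neq0//=.
    by apply/existsP; exists f; rewrite opprK.
  by rewrite (exprSr t) -[_ * t * y]mulrA -yE -[LHS]opprK xE; ring.
move=> /= /existsP[g /eqP fg] ->; apply/nonzero_squareP.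
exists k, (- (rho f + t * y)), g; split.
- by rewrite (exprSr t); ring.
- by apply: contra f0 => /eqP g0; rewrite -oppr_eq0 fg g0 expr0n.
- by rewrite rmorphN rmorphD rhoK rmorphM pi_t mul0r addr0.
Qed.

End Squares.

(** * Galois groups of quadratic polynomials *)

Section QuadraticGalois.
Variables (k : fieldType) (u d : k).
Hypothesis k2 : 2 != 0 :> k.

Definition quad_centered : {poly k} := ('X + u%:P) ^+ 2 - d%:P.
Local Notation P := quad_centered.

Lemma size_quad_centered : size P = 3.
Proof.
have sz : size (('X + u%:P) ^+ 2) = 3.
  by rewrite -[u]opprK polyCN size_exp_XsubC.
by rewrite size_polyDl sz// size_polyN (leq_ltn_trans (size_polyC_leq1 _)).
Qed.

Lemma quad_centered_irreducible : irreducible_poly P <-> ~ exists y, d = y ^+ 2.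
Proof.
split=> [[_ irrP] [y dE]|nsq].
  have dvP : 'X - (y - u)%:P %| P.
    by rewrite dvdp_XsubCl /root /P dE !hornerE subrK subrr.
  have := irrP ('X - (y - u)%:P); rewrite size_XsubC => /(_ isT dvP)/eqp_size.
  by rewrite size_XsubC size_quad_centered.
apply: cubic_irreducible; first by rewrite size_quad_centered.
move=> x; apply/negP; rewrite /root /P !hornerE subr_eq0 => /eqP dE.
by apply: nsq; exists (x + u).
Qed.

Lemma quad_centered_separable (L : fieldExtType k) : d != 0 ->
  separable_poly (map_poly (in_alg L) P).
Proof.
move=> d0; rewrite separable_map separable_poly.unlock.
apply/Bezout_eq1_coprimepP.
(* Since P' = 2 (X + u), one has (X + u) P' / (2 d) - P / d = 1. *)
exists (- d^-1%:P, (d^-1 / 2)%:P * ('X + u%:P)) => /=.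
have -> : P^`() = 2%:P * ('X + u%:P).
  rewrite /P derivB derivC subr0 deriv_exp derivD derivX derivC addr0 mul1r.
  by rewrite rmorph_nat mulr_natl.
rewrite mulrACA -!polyCM mulrC [_ * 2]divfK// /P -expr2.
by rewrite mulrN mulrBl opprB -polyCM divff// [_%:P * _ ^+ 2]mulrC subrK.
Qed.

Section Splitting.
Variables (L : fieldExtType k).
Local Notation PL := (map_poly (in_alg L) P).

Lemma map_quad_centered : PL = ('X + u%:A%:P) ^+ 2 - d%:A%:P.
Proof. by rewrite rmorphB rmorphXn rmorphD /= map_polyX !map_polyC. Qed.

Lemma root_quad_centered (z : L) : root PL z = ((z + u%:A) ^+ 2 == d%:A).
Proof. by rewrite map_quad_centered /root !hornerE subr_eq0. Qed.

Lemma quad_centered_factor (z : L) : root PL z ->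
  PL = \prod_(w <- [:: z; - (z + u%:A) - u%:A]) ('X - w%:P).
Proof.
rewrite root_quad_centered => /eqP dE.
rewrite map_quad_centered -dE big_cons big_seq1.
by rewrite !(polyCB, polyCN, polyCD, polyC_exp); ring.
Qed.

Lemma quad_centered_splitting (z : L) : root PL z -> <<1; z>>%VS = {:L}%VS ->
  splittingFieldFor 1 PL {:L}.
Proof.
move=> /quad_centered_factor PE zL; exists [:: z; - (z + u%:A) - u%:A].
  by rewrite PE eqpxx.
apply/eqP; rewrite eqEsubv subvf /= -zL adjoin_cons subv_adjoin_seq//.
Qed.

Lemma splitting_quad_centered_adjoin (z : L) : root PL z ->
  splittingFieldFor 1 PL {:L} -> <<1; z>>%VS = {:L}%VS.
Proof.
move=> rz [rs PE rsL]; apply/eqP; rewrite eqEsubv subvf /= -rsL.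
apply/Fadjoin_seqP; split=> [|w wrs]; first exact: subv_adjoin.
have : root PL w by rewrite (eqp_root PE) root_prod_XsubC.
move: rz; rewrite !root_quad_centered => /eqP <-; rewrite eqf_sqr.
have u1 : u%:A \in <<1; z>>%VS by rewrite rpredZ ?rpred1.
rewrite -[w in w \in _](addrK u%:A) => /orP[] /eqP ->.
  by rewrite addrK memv_adjoin.
by rewrite rpredB ?rpredN ?rpredD// memv_adjoin.
Qed.

End Splitting.

(** One root is enough, its reflection about -u being the other: take [k] itself if [d] is a square,
    and adjoin a root of the irreducible [P] if not. *)
Lemma quad_centered_splitting_exists : exists L : splittingFieldType k,
  splittingFieldFor 1%AS (map_poly (in_alg L) P) {:L}.
Proof.
have [[y dE]|nsq] := pselect (exists y, d = y ^+ 2).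
  exists (k^o : splittingFieldType k).
  apply: (@quad_centered_splitting _ ((y - u)%:A)).
    rewrite root_quad_centered -scalerDl subrK dE.
    by rewrite exprZn expr1n.
  by apply/eqP; rewrite eqEsubv subvf /= regular_fullv sub1v.
have [L _ [z rz zL]] := irredp_FAdjoin (quad_centered_irreducible.2 nsq).
have spl := quad_centered_splitting rz zL.
have ax : splitting_field_axiom L.
  exists (map_poly (in_alg L) P) => //.
  by apply/polyOverP => i; rewrite coef_map /= rpredZ ?rpred1.
pose M : splittingFieldType k :=
  HB.pack L (FieldExt_isSplittingField.Build k L ax).
by exists M.
Qed.

(** The splitting field is k(z) for any root z, of degree at most 2, and of degree 1 exactly when
    [d] is a square. *)
Lemma card_gal_quad_centered (L : splittingFieldType k) :
  splittingFieldFor 1%AS (map_poly (in_alg L) P) {:L} ->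
  #|'Gal({:L} / 1%AS)%g| = (if `[< exists y, d = y ^+ 2 >] then 1 else 2)%N.
Proof.
move=> spl.
have [z rz] : exists z, root (map_poly (in_alg L) P) z.
  have [[|z rs] PE _] := spl.
    have := eqp_size PE.
    by rewrite size_map_poly size_quad_centered big_nil size_poly1.
  by exists z; rewrite (eqp_root PE) root_prod_XsubC mem_head.
have zL := splitting_quad_centered_adjoin rz spl.
have Pk : map_poly (in_alg L) P \is a polyOver 1%VS.
  by apply/polyOverP => i; rewrite coef_map /= rpredZ ?rpred1.
have [gal dimL] : galois 1 {:L} /\ 
   \dim {:L} = (if `[< exists y, d = y ^+ 2 >] then 1 else 2)%N.
  case: asboolP => [[y dE]|nsq].
    have L1 : {:L}%VS = 1%VS.
      rewrite -zL; apply/Fadjoin_idP.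
      move: rz; rewrite root_quad_centered dE.
      have -> : (y ^+ 2)%:A = y%:A ^+ 2 :> L by rewrite exprZn expr1n.
      rewrite eqf_sqr -[z in z \in _](addrK u%:A).
      by case/orP => /eqP ->; rewrite rpredB ?rpredN// rpredZ ?rpred1.
    split; last by rewrite L1 dimv1.
    (* [P] has a double root when d = 0, so the constant 1 serves as separable polynomial for L =
       k. *)
    apply/splitting_galoisField; exists 1; split.
    - exact: rpred1.
    - by rewrite separable_poly.unlock coprime1p.
    - exists [::]; first by rewrite big_nil eqpxx.
      by rewrite Fadjoin_nil; exact: esym L1.
  split.
    apply/splitting_galoisField; exists (map_poly (in_alg L) P); split=> //.
    apply: quad_centered_separable; apply/eqP => d0; apply: nsq; exists 0.
    by rewrite expr0n.
  rewrite -zL; have := adjoin_degreeE 1%AS z; rewrite dimv1 divn1 => <-.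
  apply/eqP; rewrite eqn_leq; apply/andP; split.
    have : minPoly 1%AS z %| map_poly (in_alg L) P by rewrite minPoly_dvdp.
    move=> /dvdp_leq; rewrite map_poly_eq0 -size_poly_eq0 size_quad_centered.
    by rewrite size_map_poly size_quad_centered size_minPoly; apply.
  rewrite ltn_neqAle andbT eq_sym adjoin_deg_eq1.
  apply/negP => /vlineP[y zE]; apply: nsq; exists (y + u).
  move: rz; rewrite root_quad_centered zE -scalerDl exprZn expr1n => /eqP.
  by move=> /(fmorph_inj (in_alg L)).
by rewrite -galois_dim// dimv1 divn1 dimL.
Qed.

End QuadraticGalois.

(** * Haar measure *)

Section FiniteUnion.
Local Open Scope classical_set_scope.

Lemma measure_finite_union d (T : measurableType d) (R : realType)
    (mu : {measure set T -> \bar R}) (I : finType) (P : pred I)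
    (A : I -> set T) (c : R) :
  (forall i, P i -> measurable (A i)) -> (forall i, P i -> mu (A i) = c%:E) ->
  trivIset [set` P] A ->
  mu (\bigcup_(i in [set` P]) A i) = (#|P|%:R * c)%:E.
Proof.
move=> mA muA tA; rewrite measure_fin_bigcup//.
transitivity (\sum_(i | P i) mu (A i))%E.
  by apply/esym/bigfs => [|i _]; rewrite ?index_enum_uniq ?mem_index_enum.
rewrite (eq_bigr (fun=> c%:E)) => [|i Pi]; last exact: muA.
by rewrite sumEFin mulr_natl; congr (_%:E); exact: sumr_const.
Qed.

End FiniteUnion.

(** The left side is the geometric series of first term (q - 1) / (2 q) and ratio q^-2. *)
Lemma neg_square_density (R : realFieldType) (q : R) : 1 < q ->
  (q - 1) / 2 / q / (1 - q ^- 2) = 1 / 2 - 1 / (2 * q + 2).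
Proof.
move=> q1; have [q0 qB qD] : [/\ q != 0, q - 1 != 0 & q + 1 != 0].
  by split; apply: lt0r_neq0; lra.
have -> : 1 - q ^- 2 = (q - 1) * (q + 1) / q ^+ 2 by field.
have -> : 2 * q + 2 = 2 * (q + 1) by ring.
field.
by rewrite qD q0 qB.
Qed.

(** * Split quadratics and the discriminant *)

Lemma monic_size2 (A : comNzRingType) (g : {poly A}) :
  g \is monic -> size g = 2 -> g = 'X + (g`_0)%:P.
Proof.
move=> /monicP gm g2; apply/polyP => -[|[|i]];
  rewrite coefD coefX coefC ?add0r//=.
  by apply: (etrans _ (esym (addr0 _))); rewrite -gm lead_coefE g2.
by rewrite nth_default ?g2.
Qed.

Lemma mulr_XaddC (A : comNzRingType) (b c : A) :
  ('X + b%:P) * ('X + c%:P) = 'X^2 + (b + c) *: 'X + (b * c)%:P.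
Proof. by rewrite -mul_polyC polyCD polyCM; ring. Qed.

Section Quadratics.
Variables (p : nat) (p_pr : prime p) (K : fieldExtType (padic p_pr)).
Local Notation O := (ring_of_integers K).
Variables (h : O) (h2 : 2 * h = 1).

(** With [h] one half, this is (a1^2 - 4 a0) / 4, and the polynomial is (X + a1 / 2)^2 minus it. *)
Definition quarter_discr (a : borelO K * borelO K) : O := (h * a.2) ^+ 2 - a.1.

Lemma quad_inj (b c : O) (a : borelO K * borelO K) :
  quad a = 'X^2 + c *: 'X + b%:P -> a.1 = b /\ a.2 = c.
Proof.
move=> E; split.
  have := congr1 (fun g : {poly O} => g`_0) E.
  by rewrite !coefD !coefZ !coefXn !coefX !coefC /= !mulr0 !add0r.
have := congr1 (fun g : {poly O} => g`_1) E.
by rewrite !coefD !coefZ !coefXn !coefX !coefC /= !mulr1 !add0r !addr0.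
Qed.

Lemma P11E a : P11 K a <-> nonzero_square (quarter_discr a).
Proof.
split=> [[f [g [fm gm f2 g2 [fg]]]]|[y y0 dE]].
  rewrite (monic_size2 fm f2) (monic_size2 gm g2) mulr_XaddC.
  move=> /quad_inj[a1 a2]; exists (h * (f`_0 - g`_0)).
    apply: contra fg => /eqP e.
    rewrite (monic_size2 fm f2) (monic_size2 gm g2); apply/eqP.
    congr (_ + _%:P); apply/eqP; rewrite -subr_eq0 -[X in X == 0]mul1r -h2.
    by rewrite -mulrA e mulr0.
  rewrite /quarter_discr a1 a2.
  transitivity ((h * (f`_0 + g`_0)) ^+ 2 - (2 * h) ^+ 2 * (f`_0 * g`_0)).
    by rewrite h2 expr1n mul1r.
  ring.
exists ('X + (h * a.2 + y)%:P), ('X + (h * a.2 - y)%:P); split.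
- by rewrite monicE lead_coefDl ?lead_coefX// size_polyX ltnS size_polyC_leq1.
- by rewrite monicE lead_coefDl ?lead_coefX// size_polyX ltnS size_polyC_leq1.
- by rewrite size_polyDl size_polyX// ltnS size_polyC_leq1.
- by rewrite size_polyDl size_polyX// ltnS size_polyC_leq1.
split.
  apply: contra y0 => /eqP/addrI/polyC_inj/addrI/eqP.
  rewrite -subr_eq0 opprK => /eqP yy; apply/eqP.
  by rewrite -[LHS]mul1r -h2 mulrAC mulr_natl mulr2n yy mul0r.
rewrite mulr_XaddC /quad; congr (_ + _ *: _ + _%:P).
  by rewrite -[LHS]mul1r -h2; ring.
move: dE; rewrite /quarter_discr => dE.
by rewrite -[LHS](subKr ((h * a.2) ^+ 2)) dE; ring.
Qed.

End Quadratics.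

(** * Measure of balls and of the set of squares *)

Section Measure.
Import numFieldNormedType.Exports.
Local Open Scope classical_set_scope.
Variables (p : nat) (p_pr : prime p) (K : fieldExtType (padic p_pr)).
Local Notation O := (ring_of_integers K).
Variables (F : finFieldType) (pi : {rmorphism O -> F}).
Hypothesis pi_eq0 : forall x, pi x = 0 <-> ~ exists y, x * y = 1.
Variable t : O.
Hypothesis t_neq0 : t != 0.
Hypothesis pi_t : pi t = 0.
Hypothesis t_max : forall y, pi y = 0 -> exists z, y = t * z.
Hypothesis t_nilp : exists N z, t ^+ N = p%:R * z.
Variable rho : F -> O.
Hypothesis rhoK : cancel rho pi.
Hypothesis p_gt2 : (2 < p)%N.
Variables (h : O) (h2 : 2 * h = 1).

Definition ball_O (x : O) k : set (borelO K) :=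
  [set y | exists z, y = x + t ^+ k * z].

(** As [t] divides p, the ideal p^k O lies in t^k O, so balls are open. *)
Lemma measurable_ball_O x k : measurable (ball_O x k).
Proof.
apply: sub_sigma_algebra; change (padic_open (ball_O x k : set O)) => _ [z ->].
have /t_max[w pw] := residue_natp pi_eq0.
exists k => y; exists (z + w ^+ k * y).
by rewrite natrX pw exprMn; ring.
Qed.

Lemma ball_O_split x k : ball_O x k =
  \bigcup_(f in [set` @predT F]) ball_O (x + t ^+ k * rho f) k.+1.
Proof.
apply/seteqP; split=> [_ [z ->]|_ [f _ [z ->]]]; last first.
  by exists (rho f + t * z); rewrite exprSr; ring.
have /t_max[y yE] : pi (z - rho (pi z)) = 0 by rewrite rmorphB rhoK subrr.
exists (pi z) => //; exists y.
by rewrite exprSr -mulrA -yE; ring.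
Qed.

Lemma trivIset_ball_O x k (P : set F) :
  trivIset P (fun f => ball_O (x + t ^+ k * rho f) k.+1).
Proof.
move=> f g _ _ [y [[z ->] [w]]].
rewrite exprSr -!mulrA -!addrA => /addrI.
rewrite -!mulrDr => /(ring_of_integers_mulfI (uniformizer_exp_neq0 t_neq0 k)).
move=> /(congr1 pi); rewrite !rmorphD !rmorphM pi_t !mul0r !addr0 !rhoK.
by move=> ->.
Qed.

Variables (R : realType) (mu : probability (borelO K) R).
Hypothesis mu_haar : translation_invariant mu.

Lemma mu_ball_O_translate x k : mu (ball_O x k) = mu (ball_O 0 k).
Proof.
rewrite -(mu_haar x (measurable_ball_O 0 k)); congr (mu _).
apply/seteqP; split=> [_ [z ->]|_ [_ [z ->] <-]].
  by exists (t ^+ k * z) => //; exists z; rewrite add0r.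
by exists z; rewrite add0r.
Qed.

(** A ball is the disjoint union of #|F| balls of the next level, of equal mass by translation
    invariance. *)
Lemma mu_ball_O x k : mu (ball_O x k) = (#|F|%:R ^- k)%:E.
Proof.
rewrite mu_ball_O_translate; elim: k {x} => [|k IHk].
  rewrite invr1 -(@probability_setT _ _ _ mu); congr (mu _).
  by apply/seteqP; split=> // y _; exists y; rewrite add0r mul1r.
have fin : mu (ball_O 0 k.+1) \is a fin_num.
  by rewrite fin_num_measure//; exact: measurable_ball_O.
have F0 : (#|F|%:R : R) != 0.
  by rewrite pnatr_eq0 -lt0n ltnW// finNzRing_gt1.
have : mu (ball_O 0 k) = (#|F|%:R * fine (mu (ball_O 0 k.+1)))%:E.
  rewrite ball_O_split.
  rewrite (@measure_finite_union _ _ _ _ _ _ _ (fine (mu (ball_O 0 k.+1))))//.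
  - by move=> f _; exact: measurable_ball_O.
  - by move=> f _; rewrite fineK//; exact: mu_ball_O_translate.
  - exact: trivIset_ball_O.
rewrite IHk => -[e].
by rewrite -[LHS]fineK// exprS invfM e mulKf.
Qed.

(** Finite t-adic expansions, lowest digit first: a countable dense set of centers. *)
Fixpoint ball_center (s : seq F) : O :=
  if s is f :: s' then rho f + t * ball_center s' else 0.

Lemma ball_center_dense x k :
  exists s y, size s = k /\ x = ball_center s + t ^+ k * y.
Proof.
elim: k x => [|k IHk] x; first by exists [::], x; rewrite add0r mul1r.
have /t_max[y yE] : pi (x - rho (pi x)) = 0 by rewrite rmorphB rhoK subrr.
have [s [z [<- {}yEz]]] := IHk y.
exists (pi x :: s), z; split=> //=.
by rewrite exprS -mulrA -addrA -mulrDr -yEz -yE addrC subrK.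
Qed.

(* Countably many balls form a basis of the topology. *)
Lemma measurable_prod_open (A : set (borelO K * borelO K)) :
  (forall a, A a -> exists k, forall b c : O,
    A (a.1 + t ^+ k * b, a.2 + t ^+ k * c)) ->
  measurable A.
Proof.
move=> Aopen.
pose B (s : seq F * seq F) := ball_O (ball_center s.1) (size s.1) `*`
  ball_O (ball_center s.2) (size s.2).
have -> : A = \bigcup_s (if `[< B s `<=` A >] then B s else set0).
  apply/seteqP; split=> [a Aa|a [s _]]; last first.
    by case: ifPn => // /asboolP BA /BA.
  have [k Ak] := Aopen a Aa.
  have [s [y [sk aE]]] := ball_center_dense a.1 k.
  have [s' [y' [sk' aE']]] := ball_center_dense a.2 k.
  exists (s, s') => //; rewrite ifT; last first.
    apply/asboolP => -[b c] [/= [z bE] [z' cE]].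
    have := Ak (z - y) (z' - y'); congr (A (_, _)).
      by rewrite aE bE sk; ring.
    by rewrite aE' cE sk'; ring.
  by split; [exists y; rewrite sk | exists y'; rewrite sk'].
apply: countable_bigcupT_measurable => [|s]; first exact: countableP.
by case: ifP => // _; apply: measurableX; exact: measurable_ball_O.
Qed.

Lemma measurable_quarter_discr (B : set O) :
  (forall d, B d -> exists k, forall s, B (d + t ^+ k * s)) ->
  measurable [set a | B (quarter_discr h a)].
Proof.
move=> Bopen; apply: measurable_prod_open => a /= /Bopen[k Bk]; exists k => b c.
(* The argument is the increment of [quarter_discr] from a to a + t^k (b, c), divided by t^k. *)
have := Bk (2 * h ^+ 2 * a.2 * c + t ^+ k * (h * c) ^+ 2 - b); congr B.
by rewrite /quarter_discr /=; ring.
Qed.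

Lemma nu_quarter_discr (B : set O) (r : \bar R) :
  measurable [set a | B (quarter_discr h a)] ->
  (forall c : O, mu [set x : borelO K | B (c - x)] = r) ->
  (mu \x mu)%E [set a | B (quarter_discr h a)] = r.
Proof.
move=> mB muB.
(* Exchange the order of integration: with a1 fixed, [quarter_discr] is a constant minus a0, and
   every slice has mass [r]. *)
rewrite (@product_measure_unique _ _ _ _ _ mu mu (mu \x^ mu)%E)//; last first.
  by move=> *; exact: product_measure2E.
rewrite /product_measure2 -[RHS]mule1 -(@probability_setT _ _ _ mu).
rewrite -integral_cst//; apply: eq_integral => c _ /=.
rewrite -(muB ((h * c) ^+ 2)); congr (mu _).
by apply/seteqP; split=> x; rewrite /ysection /= inE.
Qed.

Lemma measurable_set1_O (x : borelO K) : measurable [set x].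
Proof.
have -> : [set x] = \bigcap_k ball_O x k.
  apply/seteqP; split=> [_ -> k _|y xy]; first by exists 0; rewrite mulr0 addr0.
  apply/eqP; rewrite -subr_eq0; apply/eqP.
  apply: (uniformizer_sep pi_eq0 t_nilp) => k.
  by have [z ->] := xy k I; exists z; rewrite addrC addKr.
by apply: bigcapT_measurable => k; exact: measurable_ball_O.
Qed.

Lemma mu_set1_O (x : borelO K) : mu [set x] = 0%E.
Proof.
have m1 := measurable_set1_O x.
have fin : mu [set x] \is a fin_num by exact: fin_num_measure.
apply/eqP; rewrite eq_le measure_ge0 andbT -(fineK fin) lee_fin leNgt.
apply/negP => r0; set r := fine _ in r0.
(* Then q^k > k > 1 / r, so balls of level [k] have mass below [r]. *)
pose k := Num.bound r^-1.
have : r <= #|F|%:R ^- k.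
  rewrite -lee_fin fineK// -(mu_ball_O x); apply: le_measure.
  - by rewrite inE.
  - by rewrite inE; exact: measurable_ball_O.
  - by move=> _ ->; exists 0; rewrite mulr0 addr0.
apply/negP; rewrite -ltNge -[r]invrK ltf_pV2 ?posrE ?invr_gt0 ?exprn_gt0//.
  apply: (@lt_le_trans _ _ k%:R).
    by apply: archi_boundP; rewrite invr_ge0 ltW.
  by rewrite -natrX ler_nat ltnW// ltn_expl// finNzRing_gt1.
by rewrite ltr0n ltnW// finNzRing_gt1.
Qed.

(** The centers carry a leading [0 +] so that [trivIset_ball_O] applies. *)
Lemma neg_nonzero_squareE : [set x : borelO K | nonzero_square (- x : O)] =
  \bigcup_k \bigcup_(f in [set` @neg_square F])
    ball_O (0 + t ^+ (2 * k) * rho f) (2 * k).+1.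
Proof.
apply/seteqP; split=> [x|x [k _ [f fP [y ->]]]] /=.
  move=> /(neg_nonzero_squareP pi_eq0 t_neq0 pi_t t_max t_nilp rhoK p_gt2).
  move=> [k [f [y [fP ->]]]]; exists k => //; exists f => //.
  by exists y; rewrite add0r.
apply/(neg_nonzero_squareP pi_eq0 t_neq0 pi_t t_max t_nilp rhoK p_gt2).
by exists k, f, y; rewrite add0r.
Qed.

Lemma measurable_neg_nonzero_square :
  measurable [set x : borelO K | nonzero_square (- x : O)].
Proof.
rewrite neg_nonzero_squareE; apply: bigcupT_measurable => k.
by apply: fin_bigcup_measurable => // f _; exact: measurable_ball_O.
Qed.

Lemma mu_neg_nonzero_square : mu [set x : borelO K | nonzero_square (- x : O)] =
  (1 / 2 - 1 / (2 * #|F|%:R + 2))%:E.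
Proof.
have [s qE] : exists s, s = #|@neg_square F| /\ #|F| = (2 * s).+1.
  exists #|@neg_square F|; split=> //; apply: card_neg_square.
  apply/eqP => F2; have /eqP := congr1 pi h2.
  rewrite rmorphM rmorph1 rmorph_nat.
  by rewrite F2 mul0r eq_sym oner_eq0.
have q_gt1 : (1 < #|F|)%N := finNzRing_gt1 F.
rewrite neg_nonzero_squareE measure_bigcup; first last.
(* Different indices give disjoint sets because an element determines its valuation, here 2 i = 2
   j. *)
- move=> i j _ _ [x [[f /andP[f0 _] [y ->]] [g /andP[g0 _] [z]]]].
  rewrite !add0r !exprSr -!mulrA -!mulrDr => E.
  have [||] := uniformizer_factor_inj t_neq0 pi_t E;
    rewrite ?rmorphD ?rmorphM ?pi_t ?mul0r ?addr0 ?rhoK//.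
  by move=> /eqP; rewrite eqn_mul2l /= => /eqP.
- move=> k _; apply: fin_bigcup_measurable => // f _.
  exact: measurable_ball_O.
set q : R := #|F|%:R.
have q1 : 1 < q by rewrite ltr1n.
have E : (fun n => \sum_(0 <= k < n | k \in [set: nat])
    mu (\bigcup_(f in [set` @neg_square F])
      ball_O (0 + t ^+ (2 * k) * rho f)%R (2 * k).+1))%E =
    EFin \o series (geometric (s%:R / q) (q ^- 2)).
  apply/funext => n /=; rewrite seriesEnat -sumEFin.
  rewrite (eq_bigl xpredT) => [|k]; last exact: mem_set.
  apply: eq_bigr => k _.
  rewrite (@measure_finite_union _ _ _ _ _ _ _ (q ^- (2 * k).+1)).
  - rewrite -qE.1 /geometric /=; congr (_%:E).
    by rewrite exprVn -exprM exprS invfM mulrA.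
  - by move=> f _; exact: measurable_ball_O.
  - by move=> f _; exact: mu_ball_O.
  - exact: trivIset_ball_O.
have z1 : `|q ^- 2| < 1.
  rewrite ger0_norm ?invr_ge0 ?exprn_ge0 ?invf_lt1 ?exprn_egt1 ?exprn_gt0 //;
    lra.
have cv := @cvg_geometric_series R (s%:R / q) _ z1.
rewrite E EFin_lim; last exact: (@is_cvg_geometric_series R _ _ z1).
congr (_%:E); transitivity (s%:R / q / (1 - q ^- 2)).
  by apply: cvg_lim; [exact: Rhausdorff|exact: cv].
have -> : s%:R = (q - 1) / 2 :> R by rewrite /q qE.2 -natr1 natrM; field.
exact: neg_square_density.
Qed.

Lemma nonzero_square_open d : nonzero_square d ->
  exists k, forall s, nonzero_square (d + t ^+ k * s).
Proof.
move=> Sd; have d0 : d != 0.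
  case: Sd => y /eqP y0 ->; apply/eqP; rewrite expr2.
  by case/ring_of_integers_mulf_eq0.
have [k kP] :=
  nonzero_square_near pi_eq0 t_neq0 pi_t t_max t_nilp rhoK p_gt2 d0.
by exists k => s; have [_ /iffRL] := kP s; apply.
Qed.

Lemma nonsquare_open d : ~ is_square d ->
  exists k, forall s, ~ is_square (d + t ^+ k * s).
Proof.
move=> /not_orP[Sd /eqP d0].
have [k kP] :=
  nonzero_square_near pi_eq0 t_neq0 pi_t t_max t_nilp rhoK p_gt2 d0.
exists k => s; have [/eqP dn0 [SS _]] := kP s.
by case=> [/SS|].
Qed.

Lemma measurable_open_O (A : set (borelO K)) :
  (forall x, A x -> exists k, forall s : O, A ((x : O) + t ^+ k * s)) ->
  measurable A.
Proof.
move=> Aopen; apply: sub_sigma_algebra; change (padic_open (A : set O)).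
move=> x /Aopen[k Ak]; have /t_max[w pw] := residue_natp pi_eq0.
by exists k => y; rewrite natrX pw exprMn -mulrA; exact: Ak.
Qed.

Lemma measurable_nonzero_square_sub (c : O) :
  measurable [set x : borelO K | nonzero_square (c - (x : O))].
Proof.
apply: measurable_open_O => x /nonzero_square_open[k Sk]; exists k => s /=.
by have := Sk (- s); rewrite mulrN opprD addrA.
Qed.

Local Notation r := (1 / 2 - 1 / (2 * #|F|%:R + 2) : R).

Lemma mu_nonzero_square_sub (c : O) :
  mu [set x : borelO K | nonzero_square (c - (x : O))] = r%:E.
Proof.
rewrite -mu_neg_nonzero_square -(mu_haar c measurable_neg_nonzero_square).
congr (mu _); apply/seteqP; split=> [x Sx|_ [x Sx <-]] /=.
  by exists (x - c : O); rewrite /= ?opprB// addrC subrK.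
by rewrite opprD addrA subrr add0r.
Qed.

(** Admitting the square 0 adds only the point x = c, which is null. *)
Lemma mu_square_sub (c : O) :
  mu [set x : borelO K | is_square (c - (x : O))] = r%:E.
Proof.
rewrite (_ : [set x | _] = [set x : borelO K | nonzero_square (c - (x : O))]
    `|` [set (c : borelO K)]).
  rewrite measureU//= ?mu_nonzero_square_sub ?mu_set1_O ?adde0//.
  - exact: measurable_nonzero_square_sub.
  - exact: measurable_set1_O.
  apply/seteqP; split=> // x [] /= /[swap] ->; rewrite subrr => -[y /eqP y0].
  by rewrite expr2 => /esym/ring_of_integers_mulf_eq0[].
apply/seteqP; split=> x /= [Sx|Sx]; [by left|right|by left|right].
  by apply/esym/eqP; rewrite -subr_eq0 Sx.
by rewrite Sx subrr.
Qed.

Lemma mu_nonsquare_sub (c : O) :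
  mu [set x : borelO K | ~ is_square (c - (x : O))] = (1 - r)%:E.
Proof.
have mS : measurable [set x : borelO K | ~ is_square (c - (x : O))].
  apply: measurable_open_O => x /nonsquare_open[k Sk]; exists k => s /=.
  by have := Sk (- s); rewrite mulrN opprD addrA.
rewrite EFinB -(mu_square_sub c) -probability_setC.
  by congr (mu _); apply/seteqP.
by rewrite -[X in measurable X]setCK; exact: measurableC.
Qed.

Lemma nu_nonzero_square :
  (mu \x mu)%E [set a | nonzero_square (quarter_discr h a)] = r%:E.
Proof.
apply: (nu_quarter_discr (B := @nonzero_square _ _ K)) mu_nonzero_square_sub.
exact: measurable_quarter_discr nonzero_square_open.
Qed.

Lemma nu_nonsquare :
  (mu \x mu)%E [set a | ~ is_square (quarter_discr h a)] = (1 - r)%:E.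
Proof.
apply: (nu_quarter_discr (B := ~` @is_square _ _ K)) mu_nonsquare_sub.
exact: measurable_quarter_discr nonsquare_open.
Qed.

Lemma nu_square : (mu \x mu)%E [set a | is_square (quarter_discr h a)] = r%:E.
Proof.
apply: (nu_quarter_discr (B := @is_square _ _ K)) mu_square_sub.
(* The squares with 0 included are not open, but the nonsquares are. *)
rewrite -[X in measurable X]setCK; apply: measurableC.
exact: (measurable_quarter_discr (B := ~` @is_square _ _ K)) nonsquare_open.
Qed.

End Measure.

(** * Densities *)

Section GaloisSets.
Local Open Scope classical_set_scope.
Variables (p : nat) (p_pr : prime p) (K : fieldExtType (padic p_pr)).
Local Notation O := (ring_of_integers K).
Local Notation val := (@int_val _ _ K).
Variables (h : O) (h2 : 2 * h = 1).

Lemma val_two_neq0 : (2 : K) != 0.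
Proof.
apply/eqP => K2; have /eqP := congr1 val h2.
rewrite rmorphM rmorph1 rmorph_nat K2 mul0r eq_sym.
by rewrite (negbTE (oner_neq0 _)).
Qed.

Lemma quadK_centered a :
  quadK a = quad_centered (val (h * a.2)) (val (quarter_discr h a)).
Proof.
rewrite /quad_centered -!map_polyC -(map_polyX val).
rewrite -rmorphD -rmorphXn -rmorphB /=.
congr (map_poly _ _); rewrite /quad /quarter_discr polyCB polyC_exp polyCM.
rewrite -mul_polyC -[a.2%:P in LHS]mul1r -polyC1 -h2 polyCM.
have -> : 2%:P = 2 :> {poly O} by rewrite rmorph_nat.
ring.
Qed.

(** A square root of [d] in K is a root of X^2 - d, hence lies in the integrally closed O. *)
Lemma val_squareP (d : O) :
  (exists y : K, val d = y ^+ 2) <-> is_square d.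
Proof.
split=> [[y dE]|[[y _ ->]|->]]; last first.
- by exists 0; rewrite expr0n; exact: rmorph0.
- by exists (val y); rewrite -rmorphXn.
have [|x xy] := @ring_of_integers_closed _ _ K y.
  exists ('X^2 - d%:P).
    rewrite monicE lead_coefDl ?lead_coefXn// size_polyXn size_polyN ltnS.
    by rewrite (leq_trans (size_polyC_leq1 _)).
  by rewrite /root rmorphB /= map_polyXn map_polyC !hornerE /= dE subrr.
have dx : d = x ^+ 2 by apply: int_val_inj; rewrite dE -xy -rmorphXn.
have [x0|x0] := eqVneq x 0; first by right; rewrite dx x0 expr0n.
by left; exists x.
Qed.

Lemma P2E : P2 K = [set a | ~ is_square (quarter_discr h a)].
Proof.
apply/seteqP; split=> a; rewrite /P2 /= quadK_centered.
  by move=> /(quad_centered_irreducible _ _).1 nsq /val_squareP.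
by move=> nsq; apply/quad_centered_irreducible => /val_squareP.
Qed.

(** The Galois group has order 1 or 2, so it is cyclic and its order determines its isomorphism
    class. *)
Lemma P_GalE (gT : finGroupType) (G : {group gT}) (a : borelO K * borelO K) :
  cyclic G -> P_Gal K G a <->
  #|G| = (if `[< is_square (quarter_discr h a) >] then 1 else 2)%N.
Proof.
move=> cG.
have e : `[< is_square (quarter_discr h a) >] =
    `[< exists y : K, val (quarter_discr h a) = y ^+ 2 >].
  by apply/asbool_equiv_eq; rewrite val_squareP.
rewrite e /P_Gal /= quadK_centered; split=> [[L [spl]]|Gn].
  move=> /card_isog <-; exact: card_gal_quad_centered val_two_neq0 _ spl.
have [L spl] := quad_centered_splitting_exists (val (h * a.2))
  (val (quarter_discr h a)).
exists L; split=> //; rewrite isog_sym isog_cyclic_card//.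
have cL := card_gal_quad_centered val_two_neq0 spl.
rewrite cL Gn eqxx andbT.
move: cL; case: ifP => _ cL; first by rewrite (card1_trivg cL) cyclic1.
by apply: prime_cyclic; rewrite cL.
Qed.

End GaloisSets.

(** Hides the choices of uniformizer and digits; only one half survives, since [quarter_discr] is
    stated with it. *)
Lemma quadratic_densities (R : realType) (p : nat) (p_pr : prime p)
    (K : fieldExtType (padic p_pr)) (F : finFieldType)
    (mu : probability (borelO K) R) :
  (2 < p)%N -> is_residue_field K F -> translation_invariant mu ->
  let r := 1 / 2 - 1 / (2 * #|F|%:R + 2) in
  exists2 h : ring_of_integers K, 2 * h = 1 &
  [/\ (mu \x mu)%E [set a | nonzero_square (quarter_discr h a)]%classic = r%:E,
      (mu \x mu)%E [set a | is_square (quarter_discr h a)]%classic = r%:E &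
      (mu \x mu)%E [set a | ~ is_square (quarter_discr h a)]%classic
        = (1 - r)%:E].
Proof.
move=> p_gt2 [pi [pi_surj pi_eq0]] mu_haar r.
have [t [t0 pt tmax tnilp]] := exists_uniformizer pi_eq0.
have [rho rhoK] := choice pi_surj.
have [h h2] := exists_half K p_gt2; exists h => //; split.
- exact: (nu_nonzero_square pi_eq0 t0 pt tmax tnilp rhoK p_gt2 h2 mu_haar).
- exact: (nu_square pi_eq0 t0 pt tmax tnilp rhoK p_gt2 h2 mu_haar).
- exact: (nu_nonsquare pi_eq0 t0 pt tmax tnilp rhoK p_gt2 h2 mu_haar).
Qed.

Theorem theorem4p1 (R : realType) (p : nat) (p_pr : prime p) (p_gt2 : (2 < p)%N)
    (K : fieldExtType (padic p_pr)) (F : finFieldType) (q : nat)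
    (resF : is_residue_field K F) (cardF : #|F| = q)
    (mu : probability (borelO K) R) (mu_haar : translation_invariant mu) :
  let nu := (mu \x mu)%E in
  [/\ nu (P_Gal K (1%G : {group 'Z_2})) = nu (P11 K),
      nu (P11 K) = (1 / 2 - 1 / (2 * q%:R + 2))%:E,
      nu (P_Gal K [set: 'Z_2]%G) = nu (P2 K) &
      nu (P2 K) = (1 / 2 + 1 / (2 * q%:R + 2))%:E].
Proof.
move=> nu; have [h h2] := quadratic_densities p_gt2 resF mu_haar.
rewrite cardF => -[nuS nuS0 nuN].
(* A double root also gives the trivial group, hence [is_square] here and [nonzero_square] for
   [P11]; their measures agree. *)
have P1S : P_Gal K (1%G : {group 'Z_2}) =
    [set a | is_square (quarter_discr h a)]%classic.
  apply/seteqP; split=> a /=.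
    by move=> /(P_GalE h2 _ (cyclic1 _)); rewrite cards1; case: asboolP.
  by move=> Sa; apply/(P_GalE h2 _ (cyclic1 _)); rewrite cards1 asboolT.
have cZ : cyclic [set: 'Z_2] by rewrite prime_cyclic// cardsT card_ord.
have PZS : P_Gal K [set: 'Z_2]%G = P2 K.
  rewrite (P2E h2); apply/seteqP; split=> a /=.
    by move=> /(P_GalE h2 _ cZ); rewrite cardsT card_ord; case: asboolP.
  by move=> Sa; apply/(P_GalE h2 _ cZ); rewrite cardsT card_ord asboolF.
have P11S : P11 K = [set a | nonzero_square (quarter_discr h a)]%classic.
  by apply/seteqP; split=> a /(P11E h2).
rewrite PZS P1S P11S (P2E h2) /nu nuS nuS0 nuN; split=> //.
by congr (_%:E); lra.
Qed.
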